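(* Let $G$ be a locally exponential Lie group and $H\subset G$ a dense locally exponential Lie subgroup. Let $\pi_H:H\to U(\mathcal H)$ be a smooth unitary representation. Then $\pi_H$ extends uniquely to a continuous unitary representation $\pi:G\to U(\mathcal H)$. This representation $\pi$ is smooth, and the spaces of smooth vectors for $\pi$ and $\pi_H$ coincide.
   Context: Lie groups are modelled on locally convex spaces. A Lie group is locally exponential if it has an exponential map that is a local diffeomorphism at $0$. A (not necessarily closed) subgroup $H$ of a locally exponential Lie group $G$ is called a locally exponential Lie subgroup if $H$ carries the structure of a locally exponential Lie group compatible with the subspace topology $H\subset G$ (this structure is then unique, the inclusion is smooth, and it induces a topological embedding of Lie algebras $\mathfrak h\subset\mathfrak g$). A unitary representation $\pi:G\to U(\mathcal H)$ on a complex Hilbert space is continuous if it is strongly continuous, and smooth if its space of smooth vectors $\mathcal H^\infty=\{v: g\mapsto\pi(g)v \text{ smooth}\}$ is dense in $\mathcal H$. *)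

(* Defs.v *)
From HB Require Import structures.
From mathcomp Require Import all_boot all_order all_algebra.
From mathcomp Require Import sesquilinear complex.
From mathcomp Require Import all_classical all_reals all_analysis.

Set Implicit Arguments.
Unset Strict Implicit.
Unset Printing Implicit Defensive.

Import Order.TTheory GRing.Theory Num.Theory.
Import numFieldNormedType.Exports.

Local Open Scope classical_set_scope.
Local Open Scope ring_scope.
Local Open Scope complex_scope.

(* A complex space with its scalars restricted to [R]: smoothness of maps into a
   complex Hilbert space is smoothness over the reals. *)
Definition realification (R : realType) (V : tvsType R[i]) : Type := V.

Section Realification.
Context (R : realType) (V : tvsType R[i]).

HB.instance Definition _ := Uniform.copy (realification V) V.
HB.instance Definition _ := TopologicalZmodule.copy (realification V) V.

Let rscale (r : R) (v : realification V) : realification V := r%:C *: (v : V).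

Let rscaleA a b v : rscale a (rscale b v) = rscale (a * b) v.
Proof. by rewrite /rscale scalerA -rmorphM. Qed.

Let rscale1 : left_id 1 rscale.
Proof. by move=> v; rewrite /rscale rmorph1 scale1r. Qed.

Let rscaleDr : right_distributive rscale +%R.
Proof. by move=> a u v; rewrite /rscale scalerDr. Qed.

Let rscaleDl v : {morph rscale^~ v : a b / a + b}.
Proof. by move=> a b; rewrite /rscale rmorphD scalerDl. Qed.

HB.instance Definition _ := GRing.Zmodule_isLmodule.Build R (realification V)
  rscaleA rscale1 rscaleDr rscaleDl.

Let rscale_continuous :
  continuous (fun z : R^o * realification V => z.1 *: z.2).
Proof.
have Ccont : continuous (fun r : R^o => r%:C : R[i]^o).
  move=> r; apply/cvgrPdist_lt => -[e e'] /=.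
  rewrite ltcE /= => /andP[/eqP -> e0].
  near=> t.
  rewrite -rmorphB /= normc_def /= expr0n /= addr0 sqrtr_sqr ltcR.
  by near: t; move: e e0; apply/(@cvgrPdist_lt R R^o); exact: cvg_id.
move=> [r v] U /= /(@scale_continuous R[i] V (r%:C, v))[[A B] /= [nA nB] AB].
exists ((fun r : R^o => r%:C : R[i]^o) @^-1` A, B).
  by split=> //=; exact: Ccont nA.
by move=> [s w] /= [As Bw]; exact: (AB (s%:C, w)).
Unshelve. all: by end_near. Qed.

HB.instance Definition _ := TopologicalZmodule_isTopologicalLmodule.Build R
  (realification V) rscale_continuous.

Let real_locally_convex : exists2 B : set_system (realification V),
  (forall b, b \in B -> convex_set b) & basis B.
Proof.
have [B Bconv Bbasis] := @locally_convex R[i] V.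
exists B => // b bB x y l xb yb.
have l0 : 0 <= l%:num%:C by rewrite (lecR 0) ge0.
have l1 : l%:num%:C <= 1 by rewrite (lecR _ 1) le1.
have := Bconv b bB x y (Itv01 l0 l1) xb yb.
suff -> : @conv _ (convex_lmodType V) (Itv01 l0 l1) x y =
          @conv _ (convex_lmodType (realification V)) l x y by [].
change (l%:num%:C *: (x : V) + (1 - l%:num%:C) *: (y : V) =
        l%:num%:C *: (x : V) + (1 - l%:num)%:C *: (y : V)).
by rewrite rmorphB (rmorph1 (real_complex R)).
Qed.

HB.instance Definition _ :=
  Uniform_isTvs.Build R (realification V) real_locally_convex.

End Realification.

Section Calculus.
Context {R : realType}.

(* The library's [derivable] and ['D_v f] are restricted to normed spaces. *)
Definition is_dir_derive (E F : tvsType R) (f : E -> F) (x v : E) (w : F) :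
    Prop :=
  t^-1 *: (f (x + t *: v) - f x) @[t --> (0 : R)^'] --> w.

(* C^n in the Michal-Bastiani sense: the directional derivative is required to
   be a C^(n-1) map of the point and the direction jointly.
   To be used with [U] open and [F] Hausdorff: then [df] is uniquely determined
   on [U `*` setT], and only the values of [f] on [U] matter. *)
Fixpoint Cn_on (n : nat) (E F : tvsType R) (U : set E) (f : E -> F) : Prop :=
  {in U, continuous f} /\
  if n is m.+1 then
    exists df : E * E -> F,
      (forall x v, U x -> is_dir_derive f x v (df (x, v))) /\
      Cn_on m (U `*` [set: E]) df
  else True.

Definition Cinfty_on (E F : tvsType R) (U : set E) (f : E -> F) : Prop :=
  forall n, Cn_on n U f.

End Calculus.

Section Manifolds.
Context {R : realType}.

Record chart (M : topologicalType) (E : tvsType R) := Chart {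
  chart_dom : set M;
  chart_map :> M -> E;
  chart_inv : E -> M;
  chart_dom_open : open chart_dom;
  chart_im_open : open (chart_map @` chart_dom);
  chart_mapK : {in chart_dom, cancel chart_map chart_inv};
  chart_map_continuous : {in chart_dom, continuous chart_map};
  chart_inv_continuous : {in chart_map @` chart_dom, continuous chart_inv} }.

(* Atlases are not required to be maximal; compatible atlases give the same
   notion of smooth map. *)
Definition atlas (M : topologicalType) (E : tvsType R)
    (A : set (chart M E)) : Prop :=
  (forall x, exists2 c, A c & chart_dom c x) /\
  (forall c d, A c -> A d ->
     Cinfty_on (c @` (chart_dom c `&` chart_dom d)) (d \o chart_inv c)).

(* To be used with [U] open. *)
Definition smooth_on (M N : topologicalType) (E F : tvsType R)
    (A : set (chart M E)) (B : set (chart N F)) (U : set M) (f : M -> N) : Prop :=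
  {in U, continuous f} /\
  forall a b, A a -> B b ->
    Cinfty_on (a @` (chart_dom a `&` U `&` f @^-1` chart_dom b))
      (b \o f \o chart_inv a).

Definition smooth (M N : topologicalType) (E F : tvsType R)
    (A : set (chart M E)) (B : set (chart N F)) (f : M -> N) : Prop :=
  smooth_on A B [set: M] f.

Definition local_diffeo_at (M N : topologicalType) (E F : tvsType R)
    (A : set (chart M E)) (B : set (chart N F)) (f : M -> N) (x : M) : Prop :=
  exists (U : set M) (g : N -> M),
    [/\ open U /\ U x, open (f @` U), {in U, cancel f g},
        smooth_on A B U f & smooth_on B A (f @` U) g].

Section ModelAtlas.
Variable E : tvsType R.

Let id_im_open : open ((id : E -> E) @` [set: E]).
Proof. by rewrite image_id; exact: openT. Qed.

Let id_continuous (D : set E) : {in D, continuous (id : E -> E)}.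
Proof. by move=> x _; exact: cvg_id. Qed.

Definition model_chart : chart E E :=
  @Chart E E setT id id openT id_im_open (fun _ _ => erefl)
    (@id_continuous _) (@id_continuous _).

Definition model_atlas : set (chart E E) := [set model_chart].

End ModelAtlas.

Section ProductAtlas.
Context (M N : topologicalType) (E F : tvsType R).
Variables (a : chart M E) (b : chart N F).

Let dom : set (M * N) := chart_dom a `*` chart_dom b.
Let map (p : M * N) : E * F := (a p.1, b p.2).
Let inv (q : E * F) : M * N := (chart_inv a q.1, chart_inv b q.2).

Let im_map : map @` dom = (a @` chart_dom a) `*` (b @` chart_dom b).
Proof.
apply/seteqP; split=> [_ [[x y] [/= xa yb] <-]|[_ _] [/= [x xa <-] [y yb <-]]].
  by split=> /=; [exists x|exists y].
by exists (x, y).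
Qed.

Let open_prod (S T : topologicalType) (A : set S) (B : set T) :
  open A -> open B -> open (A `*` B).
Proof.
move=> oA oB; rewrite openE => -[x y] [/= Ax By].
by exists (A, B) => //=; split; apply: open_nbhs_nbhs.
Qed.

Let dom_open : open dom.
Proof. by apply: open_prod; exact: chart_dom_open. Qed.

Let im_open : open (map @` dom).
Proof. by rewrite im_map; apply: open_prod; exact: chart_im_open. Qed.

Let mapK : {in dom, cancel map inv}.
Proof.
move=> [x y] /set_mem[/= xa yb].
by rewrite /map /inv /= !chart_mapK ?inE.
Qed.

Let map_continuous : {in dom, continuous map}.
Proof.
move=> [x y] /set_mem[/= xa yb] U [[P Q] /= [nP nQ] PQU].
exists (a @^-1` P, b @^-1` Q) => /=.
  by split; exact: chart_map_continuous (mem_set _) _ _.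
by move=> [x' y'] /= [Px Qy]; exact: (PQU (a x', b y')).
Qed.

Let inv_continuous : {in map @` dom, continuous inv}.
Proof.
rewrite im_map => -[x y] /set_mem[/= xa yb] U [[P Q] /= [nP nQ] PQU].
exists (chart_inv a @^-1` P, chart_inv b @^-1` Q) => /=.
  by split; exact: chart_inv_continuous (mem_set _) _ _.
by move=> [x' y'] /= [Px Qy]; exact: (PQU (chart_inv a x', chart_inv b y')).
Qed.

Definition prod_chart : chart (M * N)%type (E * F)%type :=
  Chart dom_open im_open mapK map_continuous inv_continuous.

End ProductAtlas.

Definition prod_atlas (M N : topologicalType) (E F : tvsType R)
    (A : set (chart M E)) (B : set (chart N F)) :
    set (chart (M * N)%type (E * F)%type) :=
  [set c | exists a b, [/\ A a, B b & c = prod_chart a b]].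

End Manifolds.

Arguments model_atlas {R} E.

#[short(type="preTopologicalGroupType")]
HB.structure Definition PreTopologicalGroup := {G of Topological G & Group G}.

Section LieGroups.
Context {R : realType} (E : tvsType R) (G : preTopologicalGroupType).

Record lie_group (A : set (chart G E)) : Prop := LieGroup {
  lie_group_model_hausdorff : hausdorff_space E;
  lie_group_hausdorff : hausdorff_space G;
  lie_group_atlas : atlas A;
  lie_group_mul : smooth (prod_atlas A A) A (fun p : G * G => (p.1 * p.2)%g);
  lie_group_inv : smooth A A (fun x : G => (x^-1)%g) }.

(* The Lie algebra, i.e. the tangent space at the identity, is identified with
   the model space [E] through the chart [c] around the identity: [e] maps [x]
   to the value at time 1 of the one-parameter group with velocity [x]. *)
Definition exponential_map (A : set (chart G E)) (c : chart G E) (e : E -> G) :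
    Prop :=
  [/\ smooth (model_atlas E) A e,
      forall (x : E) (s t : R), e ((s + t) *: x) = (e (s *: x) * e (t *: x))%g &
      forall x : E, t^-1 *: (c (e (t *: x)) - c 1%g) @[t --> (0 : R)^'] --> x].

Definition locally_exponential (A : set (chart G E)) : Prop :=
  lie_group A /\
  exists (c : chart G E) (e : E -> G),
    [/\ A c, chart_dom c 1%g, exponential_map A c e &
        local_diffeo_at (model_atlas E) A e 0].

End LieGroups.

Record subgroup (G : groupType) := Subgroup {
  subgroup_set :> set G;
  subgroup1 : subgroup_set 1%g;
  subgroupM : forall x y, subgroup_set x -> subgroup_set y ->
    subgroup_set (x * y)%g;
  subgroupV : forall x, subgroup_set x -> subgroup_set (x^-1)%g }.

(* The topology copied below from [set_type H] is the subspace topology. *)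
Definition subgroup_type (G : preTopologicalGroupType) (H : subgroup G) : Type :=
  set_type H.

Section SubgroupType.
Context (G : preTopologicalGroupType) (H : subgroup G).

HB.instance Definition _ := Topological.copy (subgroup_type H) (set_type H).
HB.instance Definition _ := SubChoice.on (subgroup_type H).

Let subgroup_group_closed : group_closed (mem (H : set G)).
Proof.
split; first by rewrite inE; exact: subgroup1.
move=> x y /set_mem Hx /set_mem Hy; rewrite inE.
by apply: subgroupM => //; exact: subgroupV.
Qed.

HB.instance Definition _ := SubChoice_isSubGroup.Build G (mem (H : set G))
  (subgroup_type H) subgroup_group_closed.

End SubgroupType.

Section UnitaryRepresentations.
Context {R : realType} {V : completeNormedModType R[i]}.

Definition hilbert_dot (h : {dot V for @Num.conj R[i]}) : Prop :=
  forall v, `|v| ^+ 2 = h v v.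

Record unitary (h : {dot V for @Num.conj R[i]}) (T : V -> V) : Prop := Unitary {
  unitary_linear : linear T;
  unitary_surj : forall w, exists v, T v = w;
  unitary_dot : forall u v, h (T u) (T v) = h u v }.

Record unitary_rep (h : {dot V for @Num.conj R[i]}) (G : groupType)
    (pi : G -> V -> V) : Prop := UnitaryRep {
  unitary_rep_unitary : forall g, unitary h (pi g);
  unitary_rep1 : pi 1%g = id;
  unitary_repM : forall g k, pi (g * k)%g = pi g \o pi k }.

Definition strongly_continuous (G : topologicalType) (pi : G -> V -> V) : Prop :=
  forall v, continuous (fun g => pi g v).

Definition smooth_vectors (E : tvsType R) (G : topologicalType)
    (A : set (chart G E)) (pi : G -> V -> V) : set V :=
  [set v | smooth A (model_atlas (realification V))
             (fun g => pi g v : realification V)].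

Definition smooth_rep (E : tvsType R) (G : topologicalType)
    (A : set (chart G E)) (pi : G -> V -> V) : Prop :=
  dense (smooth_vectors A pi).

End UnitaryRepresentations.

(* Main.v *)
(* Restricting to 0-neighbourhoods where exp is a diffeomorphism, the inclusion
   of H is induced by a continuous linear map phi : F -> E of Lie algebras, which
   is a topological embedding with dense range; in particular H -> G is smooth.
   The unitary operators piH(x) are isometries, so each orbit map is uniformly
   continuous and extends to G; this gives pi and its uniqueness.

   If v is smooth for pi, it is smooth for piH because H -> G is smooth.
   Conversely, a piH-smooth v has iterated derivatives
     B_n(y_1, ..., y_n) = dpiH(y_1) ... dpiH(y_n) v,
   continuous multilinear maps on F^n, which extend to C_n on E^n by density and
   completeness.  The mean value theorem on H, followed by a passage to the
   limit, shows that t^-1 (pi(exp(t y)) C_n(z) - C_n(z)) tends to C_{n+1}(y, z)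
   as t -> 0, locally uniformly in (y, z).  Hence the functions
   (x, z) |-> pi(exp x) C_n(z) are differentiable, with derivatives of the same
   form, and are therefore smooth; for n = 0 this is the smoothness of v. *)

Require Import Defs.
From mathcomp Require Import all_boot all_order all_algebra.
From mathcomp Require Import sesquilinear complex.
From mathcomp Require Import all_classical all_reals all_analysis.
From mathcomp Require Import ring.

Set Implicit Arguments.
Unset Strict Implicit.
Unset Printing Implicit Defensive.

Import Order.TTheory GRing.Theory Num.Theory.
Import numFieldNormedType.Exports.

Local Open Scope classical_set_scope.
Local Open Scope ring_scope.
Local Open Scope complex_scope.

(** * Differential calculus in locally convex spaces *)

(** The model spaces carry no norm, so estimates are phrased with convex neighbourhoods, and local
    uniformity with product filters. The limit has to be joint in (y, z): passing from exp x to
    exp(x + t x') multiplies exp x on the right by exp(t y_t), where y_t = t^-1 log(exp(-x) exp(x +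
    t x')) varies with t and merely converges. Its limit, the logarithmic derivative of exp, is a
    partial derivative of the multiplication in logarithmic coordinates, so neither a Lie bracket
    nor a series for the product appears.

    The map phi does not come from differentiating the inclusion, whose smoothness is a consequence:
    a one-parameter group of H is a continuous one-parameter group of G, and each of these is t |->
    exp(t x), because square roots near the identity are unique.

    E and F are not assumed complete; the B_n extend because the Hilbert space is. They are not
    uniformly continuous, but they satisfy a Cauchy condition near each point of E^n, and that
    suffices. *)

Section Tvs.
Context {R : realType}.

Lemma tvs_cvgD (E : tvsType R) (T : Type) (Fi : set_system T) {FF : Filter Fi}
    (f g : T -> E) (a b : E) :
  f @ Fi --> a -> g @ Fi --> b -> (fun t => f t + g t) @ Fi --> a + b.
Proof. by move=> fa gb; apply: cvg_comp2 fa gb (add_continuous (a, b)). Qed.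

Lemma tvs_cvgZ (E : tvsType R) (T : Type) (Fi : set_system T) {FF : Filter Fi}
    (s : T -> R) (f : T -> E) (r : R) (a : E) :
  s @ Fi --> r -> f @ Fi --> a -> (fun t => s t *: f t) @ Fi --> r *: a.
Proof. by move=> sr fa; apply: cvg_comp2 sr fa (@scale_continuous R E (r, a)). Qed.

Lemma tvs_cvgN (E : tvsType R) (T : Type) (Fi : set_system T) {FF : Filter Fi}
    (f : T -> E) (a : E) :
  f @ Fi --> a -> (fun t => - f t) @ Fi --> - a.
Proof. by move=> fa; apply: cvg_comp fa (opp_continuous a). Qed.

Lemma tvs_cvgB (E : tvsType R) (T : Type) (Fi : set_system T) {FF : Filter Fi}
    (f g : T -> E) (a b : E) :
  f @ Fi --> a -> g @ Fi --> b -> (fun t => f t - g t) @ Fi --> a - b.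
Proof. by move=> fa gb; apply: tvs_cvgD fa (tvs_cvgN gb). Qed.

Definition convex_subset (E : tvsType R) (K : set E) : Prop :=
  forall (x y : E) (s : R), 0 <= s <= 1 -> K x -> K y ->
    K (s *: x + (1 - s) *: y).

Lemma convex_open_nbhs (E : tvsType R) (x : E) (U : set E) : nbhs x U ->
  exists K, [/\ open K, K x, convex_subset K & K `<=` U].
Proof.
have [B Bconv [Bopen Bbasis]] := @locally_convex R E.
move=> /Bbasis[K [BK Kx] KU]; exists K; split => //; first exact: Bopen.
move=> y z s /andP[s0 s1] Ky Kz.
have := Bconv K (mem_set BK) y z (Itv01 s0 s1) (mem_set Ky) (mem_set Kz).
by move/set_mem.
Qed.

Lemma convex_subset0 (E : tvsType R) (K : set E) (x : E) (s : R) :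
  convex_subset K -> K 0 -> K x -> 0 <= s <= 1 -> K (s *: x).
Proof.
by move=> cK K0 Kx s01; have := cK _ _ _ s01 Kx K0; rewrite scaler0 addr0.
Qed.

(* [good a b] is stable under concatenation by convexity and holds for short
   intervals next to any point; a supremum argument then reaches 1. *)
Lemma convex_mean_value (E : tvsType R) (K : set E) (u u' : R -> E) :
  convex_subset K ->
  (forall s, 0 <= s <= 1 -> nbhs (u' s) K) ->
  (forall s, 0 <= s <= 1 ->
     t^-1 *: (u (s + t) - u s) @[t --> (0 : R)^'] --> u' s) ->
  K (u 1 - u 0).
Proof.
move=> cK Ku' du.
pose good a b := exists2 k, K k & u b - u a = (b - a) *: k.
have good_trans a b c : a <= b -> b <= c -> good a b -> good b c -> good a c.
  move=> ab bc [k Kk uk] [l Kl ul].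
  have [ac|ac] := eqVneq a c.
    have eab : b = a by apply/eqP; rewrite eq_le ab ac bc.
    by exists k => //; rewrite -ac -{1}eab uk eab.
  have ca : 0 < c - a by rewrite subr_gt0 lt_neqAle ac (le_trans ab).
  (* The slope over the union is the average of the two slopes, weighted by the lengths of the
     intervals. *)
  exists (((b - a) / (c - a)) *: k + (1 - (b - a) / (c - a)) *: l).
    apply: cK => //; apply/andP; split.
      by rewrite divr_ge0 ?subr_ge0 // (le_trans ab).
    by rewrite ler_pdivrMr // mul1r lerD2r.
  have -> : 1 - (b - a) / (c - a) = (c - b) / (c - a).
    by field; rewrite gt_eqF.
  rewrite scalerDr !scalerA ![_ * (_ / _)]mulrC !mulfVK ?gt_eqF //.
  by rewrite -uk -ul [RHS]addrC addrA subrK.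
have loc s : 0 <= s <= 1 ->
    exists2 d : R, 0 < d & forall t, 0 < `|t| -> `|t| < d ->
      K (t^-1 *: (u (s + t) - u s)).
  move=> s01; have := du s s01 K (Ku' s s01).
  move=> -[d /= d0 dK]; exists d => // t t0 td.
  by apply: dK; rewrite /= ?sub0r ?normrN // -normr_gt0.
have goodl s d t : 0 < d -> (forall t, 0 < `|t| -> `|t| < d ->
      K (t^-1 *: (u (s + t) - u s))) -> s - d < t -> t < s -> good t s.
  move=> d0 dK dt ts.
  have nts : `|t - s| = s - t by rewrite distrC gtr0_norm // subr_gt0.
  exists ((t - s)^-1 *: (u (s + (t - s)) - u s)).
    by apply: dK; rewrite nts; [rewrite subr_gt0 | rewrite ltrBlDl -ltrBlDr].
  rewrite subrKC -(opprB t s) scalerA mulNr divff ?scaleN1r ?opprB //.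
  by rewrite subr_eq0 lt_eqF.
have goodr s d t : 0 < d -> (forall t, 0 < `|t| -> `|t| < d ->
      K (t^-1 *: (u (s + t) - u s))) -> t < s + d -> s < t -> good s t.
  move=> d0 dK dt st.
  have nts : `|t - s| = t - s by rewrite gtr0_norm // subr_gt0.
  exists ((t - s)^-1 *: (u (s + (t - s)) - u s)).
    by apply: dK; rewrite nts ?subr_gt0 // ltrBlDl.
  by rewrite subrKC scalerA divff ?scale1r // subr_eq0 gt_eqF.
pose S := [set t | 0 <= t <= 1 /\ good 0 t].
have zero01 : 0 <= (0 : R) <= 1 by rewrite lexx ler01.
have S0 : S 0.
  split=> //; exists (u' 0); first exact: nbhs_singleton (Ku' _ zero01).
  by rewrite !subrr scale0r.
have supS : has_sup S by split; [exists 0 | exists 1 => t [/andP[]]].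
set s := sup S.
have s0 : 0 <= s by exact: sup_upper_bound.
have s1 : s <= 1 by apply: ge_sup; [exists 0|move=> t [/andP[]]].
have s01 : 0 <= s <= 1 by rewrite s0.
have [d d0 dK] := loc s s01.
have [t [/andP[t0 t1] gt] st] := sup_adherent d0 supS.
have ts : t <= s by apply: sup_upper_bound => //; split => //; rewrite t0.
have gs : good 0 s.
  move: ts; rewrite le_eqVlt => /orP[/eqP <- //|ts].
  by apply: (good_trans 0 t s) => //; [exact: ltW|exact: (goodl s d t)].
(* If [s < 1], a short interval to the right of [s] would extend [S] beyond its supremum. *)
have {t t0 t1 gt st ts} es1 : s = 1.
  apply/eqP; rewrite eq_le s1 leNgt; apply/negP => slt1.
  pose r := Num.min 1 (s + d / 2).
  have sr : s < r by rewrite /r lt_min slt1 ltrDl divr_gt0.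
  have rsd : r < s + d.
    rewrite /r gt_min; apply/orP; right.
    by rewrite ltrD2l ltr_pdivrMr // ltr_pMr // ltr1n.
  have : S r.
    split; first by rewrite (le_trans s0 (ltW sr)) /r ge_min lexx.
    by apply: (good_trans 0 s r) => //; [exact: ltW|exact: (goodr s d r)].
  by move=> /(sup_upper_bound supS); rewrite leNgt sr.
move: gs; rewrite es1 => -[k Kk ->].
by rewrite subr0 scale1r.
Qed.

End Tvs.

Lemma near_cvg (T U : Type) (Fi : set_system T) {FF : Filter Fi}
    (G : set_system U) (f g : T -> U) :
  (\forall x \near Fi, f x = g x) -> f @ Fi --> G -> g @ Fi --> G.
Proof.
by move=> fg fG A /fG fA; apply: filterS2 fg fA => x; rewrite /= => ->.
Qed.

Lemma cvg_filter_prod (T T1 T2 : Type) (Fi : set_system T) {FF : Filter Fi}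
    (F1 : set_system T1) (F2 : set_system T2) (f : T -> T1) (g : T -> T2) :
  f @ Fi --> F1 -> g @ Fi --> F2 ->
  (fun i => (f i, g i)) @ Fi --> filter_prod F1 F2.
Proof.
move=> f1 g2 S [[A B] [/= nA nB] AB].
have fA : Fi (f @^-1` A) by exact: f1.
have gB : Fi (g @^-1` B) by exact: g2.
change (Fi ((fun i => (f i, g i)) @^-1` S)).
by apply: filterS2 fA gB => i fi gi; apply: AB; split.
Qed.

(** * Strict differentiability and linearity of the differential *)

Section Differential.
Context {R : realType}.

Lemma line_cvg (E : tvsType R) (x v : E) :
  x + t *: v @[t --> (0 : R)^'] --> x.
Proof.
rewrite -[X in _ --> X]addr0 -[X in _ --> _ + X](scale0r v).
apply: tvs_cvgD; first exact: cvg_cst.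
by apply: tvs_cvgZ; [exact: cvg_within|exact: cvg_cst].
Qed.

Lemma dir_derive_near (E F : tvsType R) (f g : E -> F) (x v : E) (w : F) :
  (\forall y \near x, f y = g y) ->
  is_dir_derive f x v w -> is_dir_derive g x v w.
Proof.
move=> fg; apply: near_cvg; rewrite (nbhs_singleton fg).
near=> t; congr (_ *: (_ - _)); near: t; exact: (@line_cvg _ x v _ fg).
Unshelve. all: by end_near. Qed.

Lemma dir_derive_unique (E F : tvsType R) (f : E -> F) (x v : E) (w1 w2 : F) :
  hausdorff_space F ->
  is_dir_derive f x v w1 -> is_dir_derive f x v w2 -> w1 = w2.
Proof. by move=> hF; exact: cvg_unique. Qed.

(** Parametrises the segment from [x] to [x + t *: v] by [s] in [0, 1], as [convex_mean_value]
    requires. With [c = t^-1] the total increment becomes a difference quotient. *)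
Lemma dir_derive_line (E F : tvsType R) (f : E -> F) (x v : E) (c s t : R) (w : F) :
  is_dir_derive f (x + (s * t) *: v) v w ->
  r^-1 *: (c *: f (x + ((s + r) * t) *: v) - c *: f (x + (s * t) *: v))
    @[r --> (0 : R)^'] --> (c * t) *: w.
Proof.
have [->|t0] := eqVneq t 0.
  move=> _; rewrite !mulr0 !scale0r.
  under eq_fun do rewrite !mulr0 ?scale0r subrr scaler0.
  exact: cvg_cst.
move=> df.
have tr : r * t @[r --> (0 : R)^'] --> (0 : R)^'.
  move=> A [d /= d0 dA]; exists (d / `|t|) => /=; first by rewrite divr_gt0 ?normr_gt0.
  move=> r /=; rewrite sub0r normrN => rd r0; apply: dA; rewrite /= ?mulf_neq0 //.
  by rewrite sub0r normrN normrM -ltr_pdivlMr ?normr_gt0.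
apply: near_cvg (tvs_cvgZ (@cvg_cst _ (c * t) _ ((0 : R)^') _)
  (cvg_comp _ _ tr df)).
near=> r.
have r0 : r != 0 by near: r; exact: nbhs_dnbhs_neq.
rewrite /= mulrDl scalerDl addrA -scalerBr !scalerA; congr (_ *: _).
by field; rewrite r0.
Unshelve. all: by end_near. Qed.

Definition C1_deriv (E F : tvsType R) (U : set E) (f : E -> F)
    (df : E * E -> F) : Prop :=
  (forall x v, U x -> is_dir_derive f x v (df (x, v))) /\
  {in U `*` [set: E], continuous df}.

(** Base point and direction may move while the step shrinks: along a short segment near [(x, v)]
    all derivatives lie in one convex neighbourhood of [df (x, v)], and the mean value theorem puts
    the difference quotient there as well. *)
Lemma strict_derive (E F : tvsType R) (U : set E) (f : E -> F) (df : E * E -> F)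
    (x v : E) : open U -> C1_deriv U f df -> U x ->
  p.1^-1 *: (f (p.2.1 + p.1 *: p.2.2) - f p.2.1)
    @[p --> filter_prod ((0 : R)^') (nbhs (x, v))] --> df (x, v).
Proof.
move=> oU [dfP dfC] Ux W Wx.
have [K [oK Kx cK KW]] := convex_open_nbhs Wx.
have xvU : (x, v) \in U `*` [set: E] by rewrite inE.
have nD : nbhs (x, v) [set p : E * E | U p.1 /\ K (df p)].
  apply: filterI; last by apply: (dfC _ xvU); exact: open_nbhs_nbhs.
  by apply: (@cvg_fst _ _ (nbhs x) (nbhs v)); exact: open_nbhs_nbhs.
(* The neighbourhoods of 0 are not punctured here, because the segment [s |-> y + (s * t) *: w]
   contains its initial point. *)
have theta : (fun q : R * (E * E) => (q.2.1 + q.1 *: q.2.2, q.2.2))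
    @ filter_prod (nbhs (0 : R)) (nbhs (x, v)) --> (x, v).
  pose FP := filter_prod (nbhs (0 : R)) (nbhs (x, v)).
  have cv : (fun q : R * (E * E) => q.2.2) @ FP --> v.
    by apply: cvg_comp cvg_snd _; exact: cvg_snd.
  have cx : (fun q : R * (E * E) => q.2.1) @ FP --> x.
    by apply: cvg_comp cvg_snd _; exact: cvg_fst.
  have c0 : (fun q : R * (E * E) => q.1) @ FP --> (0 : R) by exact: cvg_fst.
  have := tvs_cvgD cx (tvs_cvgZ c0 cv); rewrite scale0r addr0 => cxv.
  by apply: cvg_pair; [exact: cxv|exact: cv].
have [[A P] /= [[d /= d0 dA] nP] AP] := theta _ nD.
exists ([set t | `|t| < d /\ t != 0], P) => /=.
  split => //; exists d => //= t /= td t0; split => //.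
  by move: td; rewrite sub0r normrN.
move=> [t [y w]] /= [[td t0] Pyw]; apply: KW.
have sP (s : R) : 0 <= s <= 1 -> U (y + (s * t) *: w) /\ K (df (y + (s * t) *: w, w)).
  move=> /andP[s0 s1]; apply: (AP (s * t, (y, w))); split => //=; apply: dA.
  rewrite /= sub0r normrN normrM (ger0_norm s0) (le_lt_trans _ td) //.
  by rewrite ler_piMl.
have := @convex_mean_value R F K (fun s => t^-1 *: f (y + (s * t) *: w))
  (fun s => df (y + (s * t) *: w, w)) cK.
rewrite mul1r mul0r scale0r addr0 -scalerBr; apply.
  by move=> s /sP[_ Ks]; exact: open_nbhs_nbhs.
move=> s /sP[Us _]; have := @dir_derive_line _ _ f y w t^-1 s t _ (dfP _ w Us).
by rewrite mulVf // scale1r.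
Unshelve. all: by end_near. Qed.

Lemma strict_derive_comp (E F : tvsType R) (U : set E) (f : E -> F)
    (df : E * E -> F) (x v : E) (T : Type) (Fi : set_system T) {FF : Filter Fi}
    (r : T -> R) (a b : T -> E) : open U -> C1_deriv U f df -> U x ->
  r @ Fi --> (0 : R)^' -> a @ Fi --> x -> b @ Fi --> v ->
  (r i)^-1 *: (f (a i + r i *: b i) - f (a i)) @[i --> Fi] --> df (x, v).
Proof.
move=> oU dfP Ux r0 ax bv; have st := @strict_derive _ _ U f df x v oU dfP Ux.
have abc : (fun i => (a i, b i)) @ Fi --> (x, v).
  by apply: cvg_pair; [exact: ax|exact: bv].
exact: cvg_comp (cvg_filter_prod r0 abc) st.
Qed.

(** For additivity the increment is split at [x + r *: w]. The first part then has a moving base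
    point, which strict differentiability allows. *)
Lemma deriv_linear (E F : tvsType R) (U : set E) (f : E -> F)
    (df : E * E -> F) (x : E) : hausdorff_space F -> open U -> C1_deriv U f df ->
  U x -> linear (fun v => df (x, v)).
Proof.
move=> hF oU dfP Ux a v w.
have id0 : id @ (0 : R)^' --> (0 : R)^' by exact: cvg_id.
have dw : is_dir_derive f x w (df (x, w)) by exact: dfP.1.
have scale1 : is_dir_derive f x (a *: v) (a *: df (x, v)).
  have := @dir_derive_line _ _ f x v 1 0 a (df (x, v)).
  rewrite mul0r scale0r addr0 mul1r => /(_ (dfP.1 x v Ux)).
  apply: near_cvg; near=> r; rewrite !scale1r add0r.
  by rewrite scalerA.
have dsum : r^-1 *: (f (x + r *: w + r *: (a *: v)) - f (x + r *: w))
    + r^-1 *: (f (x + r *: w) - f x) @[r --> (0 : R)^'] -->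
    df (x, a *: v) + df (x, w).
  apply: tvs_cvgD; last exact: dw.
  have := strict_derive_comp oU dfP Ux id0 (@line_cvg _ x w) (cvg_cst (a *: v)).
  exact.
apply: (dir_derive_unique hF (dfP.1 x (a *: v + w) Ux)).
have e : df (x, a *: v) = a *: df (x, v).
  exact: (dir_derive_unique hF (dfP.1 x (a *: v) Ux)).
rewrite -e; apply: near_cvg dsum; near=> r.
rewrite /= -[LHS]scalerDr addrA subrK; congr (_ *: (f _ - f x)).
by rewrite scalerDr addrAC addrA.
Unshelve. all: by end_near. Qed.

End Differential.

(** * Calculus of maps of class C^n *)

Section Cn.
Context {R : realType}.

Lemma open_setX (S T : topologicalType) (A : set S) (B : set T) :
  open A -> open B -> open (A `*` B).
Proof.
move=> oA oB; rewrite openE => -[x y] [/= Ax By].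
by exists (A, B) => //=; split; exact: open_nbhs_nbhs.
Qed.

Lemma Cn_on_continuous n (E F : tvsType R) (U : set E) (f : E -> F) :
  Cn_on n U f -> {in U, continuous f}.
Proof. by case: n => [|n] []. Qed.

Lemma Cn_on_S n (E F : tvsType R) (U : set E) (f : E -> F) :
  Cn_on n.+1 U f -> Cn_on n U f.
Proof.
elim: n E U f => [|n IHn] E U f [cf [df [dfP Cdf]]]; first by split.
by split=> //; exists df; split => //; exact: IHn.
Qed.

Lemma Cn_on_sub n (E F : tvsType R) (U W : set E) (f : E -> F) :
  W `<=` U -> Cn_on n U f -> Cn_on n W f.
Proof.
elim: n E U W f => [|n IHn] E U W f WU [cf Cf].
  by split=> // x /set_mem/WU/mem_set/cf.
split; first by move=> x /set_mem/WU/mem_set/cf.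
case: Cf => df [dfP Cdf]; exists df; split; first by move=> x v /WU/dfP.
by apply: IHn Cdf => -[x v] [/= /WU].
Qed.

Lemma Cn_on_eq n (E F : tvsType R) (U : set E) (f g : E -> F) :
  open U -> (forall x, U x -> f x = g x) -> Cn_on n U f -> Cn_on n U g.
Proof.
move=> oU fg Cf; have cf := Cn_on_continuous Cf.
have near_fg x : U x -> \forall y \near x, f y = g y.
  by move=> Ux; apply: filterS (open_nbhs_nbhs (conj oU Ux)) => y /fg.
have cg : {in U, continuous g}.
  move=> x xU; have Ux := set_mem xU; rewrite /= /continuous_at -fg //.
  by apply: near_cvg (near_fg x Ux) _; exact: cf.
case: n Cf => [|n] [_ Cf]; split => //.
case: Cf => df [dfP Cdf]; exists df; split => // x v Ux.
exact: dir_derive_near (near_fg x Ux) (dfP x v Ux).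
Qed.

(** The derivative is chosen point by point. Since limits in [F] are unique, it agrees with every
    local derivative and inherits its regularity. *)
Lemma Cn_on_local n (E F : tvsType R) (U : set E) (f : E -> F) :
  hausdorff_space F -> open U ->
  (forall x, U x -> exists W, [/\ open W, W x & Cn_on n W f]) -> Cn_on n U f.
Proof.
move=> hF; elim: n E U f => [|n IHn] E U f oU loc.
  split=> // x /set_mem/loc[W [oW Wx [+ _]]]; apply; exact: mem_set.
split.
  move=> x /set_mem/loc[W [oW Wx [+ _]]]; apply; exact: mem_set.
have /choice[df dfP] (p : E * E) : exists w, U p.1 -> is_dir_derive f p.1 p.2 w.
  have [/loc[W [oW Wp [_ [df [dfP _]]]]]|nU] := pselect (U p.1).
    by exists (df p) => _; case: p Wp => x v; exact: dfP.
  (* Default value outside [U]. *)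
  by exists 0.
exists df; split => [x v Ux|]; first exact: (dfP (x, v)).
apply: IHn; first by apply: open_setX => //; exact: openT.
move=> [x v] [/= Ux _].
have [W [oW Wx [_ [dg [dgP Cdg]]]]] := loc x Ux.
exists ((U `&` W) `*` [set: E]); split=> //.
  by apply: open_setX; [exact: openI|exact: openT].
apply: (@Cn_on_eq n _ _ _ dg).
- by apply: open_setX; [exact: openI|exact: openT].
- move=> [y w] [/= [Uy Wy] _].
  exact: (dir_derive_unique hF (dgP y w Wy) (dfP (y, w) Uy)).
- by apply: Cn_on_sub Cdg => -[y w] [/= [_ Wy] _].
Qed.

Lemma Cn_on_cst n (E F : tvsType R) (U : set E) (a : F) :
  Cn_on n U (fun=> a : F).
Proof.
elim: n E U a => [|n IHn] E U a; first by split=> // x _; exact: cvg_cst.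
split; first by move=> x _; exact: cvg_cst.
exists (fun=> 0); split; last exact: IHn.
move=> x v Ux; rewrite /is_dir_derive; under eq_fun do rewrite subrr scaler0.
exact: cvg_cst.
Qed.

Lemma Cn_on_linear n (E F : tvsType R) (U : set E) (L : E -> F) :
  linear L -> continuous L -> Cn_on n U L.
Proof.
elim: n E U L => [|n IHn] E U L linL cL; first by split=> // x _; exact: cL.
split; first by move=> x _; exact: cL.
exists (fun p => L p.2); split.
  move=> x v _; have : (fun=> L v) @ (0 : R)^' --> L v by exact: cvg_cst.
  apply: near_cvg; near=> t.
  have t0 : t != 0 by near: t; exact: nbhs_dnbhs_neq.
  by rewrite [x + _]addrC linL addrK scalerA mulVf // scale1r.
apply: IHn; first by move=> a [x v] [y w] /=; exact: linL.
by move=> p; apply: continuous_comp; [exact: cvg_snd|exact: cL].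
Unshelve. all: by end_near. Qed.

Lemma cvg_pairP (E F : topologicalType) (T : Type) (Fi : set_system T)
    {FF : Filter Fi} (f : T -> E) (g : T -> F) (a : E) (b : F) :
  f @ Fi --> a -> g @ Fi --> b -> (fun t => (f t, g t)) @ Fi --> (a, b).
Proof. by move=> fa gb; apply: cvg_pair; [exact: fa|exact: gb]. Qed.

Lemma Cn_on_pair n (E F1 F2 : tvsType R) (U : set E) (f : E -> F1)
    (g : E -> F2) :
  Cn_on n U f -> Cn_on n U g ->
  Cn_on n U (fun x => (f x, g x) : (F1 * F2)%type).
Proof.
elim: n E U f g => [|n IHn] E U f g [cf Cf] [cg Cg].
  by split=> // x xU; apply: cvg_pairP; [exact: cf|exact: cg].
split; first by move=> x xU; apply: cvg_pairP; [exact: cf|exact: cg].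
move: Cf Cg => [df [dfP Cdf]] [dg [dgP Cdg]].
exists (fun p => (df p, dg p)); split; last exact: IHn.
move=> x v Ux.
exact: cvg_pairP (dfP x v Ux) (dgP x v Ux).
Qed.

Lemma fst_linear (E F : tvsType R) : linear (fst : E * F -> E).
Proof. by move=> a [x v] [y w]. Qed.

Lemma snd_linear (E F : tvsType R) : linear (snd : E * F -> F).
Proof. by move=> a [x v] [y w]. Qed.

Lemma fst_continuous (E F : topologicalType) : continuous (fst : E * F -> E).
Proof. by move=> p; exact: cvg_fst. Qed.

Lemma snd_continuous (E F : topologicalType) : continuous (snd : E * F -> F).
Proof. by move=> p; exact: cvg_snd. Qed.

Lemma Cn_on_fst n (E F : tvsType R) (U : set (E * F)) : Cn_on n U (fst : E * F -> E).
Proof. by apply: Cn_on_linear; [exact: fst_linear|exact: fst_continuous]. Qed.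

Lemma Cn_on_snd n (E F : tvsType R) (U : set (E * F)) : Cn_on n U (snd : E * F -> F).
Proof. by apply: Cn_on_linear; [exact: snd_linear|exact: snd_continuous]. Qed.

Lemma Cn_on_id n (E : tvsType R) (U : set E) : Cn_on n U (id : E -> E).
Proof. by apply: Cn_on_linear => // x; exact: cvg_id. Qed.

Lemma C1_deriv_Cn n (E F : tvsType R) (U : set E) (f : E -> F) (df : E * E -> F) :
  (forall x v, U x -> is_dir_derive f x v (df (x, v))) ->
  Cn_on n (U `*` [set: E]) df -> C1_deriv U f df.
Proof. by move=> dfP /Cn_on_continuous Cdf; split. Qed.

Lemma Cn_on_comp n (E F Z : tvsType R) (U : set E) (W : set F) (f : E -> F)
    (g : F -> Z) :
  open U -> open W -> (forall x, U x -> W (f x)) -> Cn_on n U f -> Cn_on n W g ->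
  Cn_on n U (g \o f).
Proof.
elim: n E F Z U W f g => [|n IHn] E F Z U W f g oU oW UW Cf Cg.
  split=> // x xU; apply: continuous_comp; first exact: Cf.1.
  by apply: Cg.1; apply/mem_set/UW/set_mem.
split.
  move=> x xU; apply: continuous_comp; first exact: Cf.1.
  by apply: Cg.1; apply/mem_set/UW/set_mem.
have Cf' := Cn_on_S Cf.
move: Cf Cg => [cf [df [dfP Cdf]]] [cg [dg [dgP Cdg]]].
exists (dg \o (fun p => (f p.1, df p))); split.
  move=> x v Ux; have Wfx := UW _ Ux.
  (* The increment of [f] is [t] times a direction that converges to [df (x, v)], so strict
     differentiability of [g] gives the chain rule. *)
  have : t^-1 *: (g (f x + t *: (t^-1 *: (f (x + t *: v) - f x))) - g (f x))
      @[t --> (0 : R)^'] --> dg (f x, df (x, v)).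
    have st := @strict_derive_comp _ _ _ W g dg (f x) (df (x, v)) _ ((0 : R)^')
      _ id (fun=> f x) _ oW (C1_deriv_Cn dgP Cdg) Wfx.
    by apply: st; [exact: cvg_id|exact: cvg_cst|exact: dfP].
  apply: near_cvg; near=> t.
  have t0 : t != 0 by near: t; exact: nbhs_dnbhs_neq.
  by rewrite /= scalerA divff // scale1r subrKC.
apply: (IHn _ _ _ _ (W `*` [set: F])) => //.
- by apply: open_setX => //; exact: openT.
- by apply: open_setX => //; exact: openT.
- by move=> [x v] [/= Ux _]; split => //; exact: UW.
- apply: Cn_on_pair => //.
  apply: (IHn _ _ _ _ U fst f) => //.
  + by apply: open_setX => //; exact: openT.
  + by move=> [x v] [].
  + exact: Cn_on_fst.
Unshelve. all: by end_near. Qed.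

Lemma Cn_on_add n (E F : tvsType R) (U : set E) (f g : E -> F) :
  open U -> Cn_on n U f -> Cn_on n U g -> Cn_on n U (fun x => f x + g x).
Proof.
move=> oU Cf Cg.
apply: (@Cn_on_comp n _ _ _ U setT (fun x => (f x, g x)) (fun p => p.1 + p.2)) => //.
- exact: openT.
- exact: Cn_on_pair.
- apply: Cn_on_linear; last exact: add_continuous.
  by move=> a [x v] [y w] /=; rewrite scalerDr addrACA.
Qed.

End Cn.

Section Cinfty.
Context {R : realType}.

(** [Cinfty_on] supplies a possibly different derivative for each order; by uniqueness they coincide
    over [U], so a single one serves all orders. *)
Lemma Cinfty_deriv (E F : tvsType R) (U : set E) (f : E -> F) :
  hausdorff_space F -> open U -> Cinfty_on U f ->
  exists df : E * E -> F,
    (forall x v, U x -> is_dir_derive f x v (df (x, v))) /\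
    Cinfty_on (U `*` [set: E]) df.
Proof.
move=> hF oU Cf; have [_ [df [dfP _]]] := Cf 1%N.
exists df; split => // n; have [_ [dg [dgP Cdg]]] := Cf n.+1.
apply: Cn_on_eq Cdg; first by apply: open_setX => //; exact: openT.
by move=> [x v] [/= Ux _]; exact: (dir_derive_unique hF (dgP _ _ Ux) (dfP _ _ Ux)).
Qed.

Lemma Cinfty_comp (E F Z : tvsType R) (U : set E) (W : set F) (f : E -> F)
    (g : F -> Z) :
  open U -> open W -> (forall x, U x -> W (f x)) -> Cinfty_on U f ->
  Cinfty_on W g -> Cinfty_on U (g \o f).
Proof. by move=> oU oW UW Cf Cg n; exact: Cn_on_comp oU oW UW (Cf n) (Cg n). Qed.

End Cinfty.

(** * Smooth maps between manifolds *)

Section SmoothMaps.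
Context {R : realType}.

Lemma open_in_preimage (M N : topologicalType) (U : set M) (W : set N)
    (f : M -> N) :
  open U -> {in U, continuous f} -> open W -> open (U `&` f @^-1` W).
Proof.
move=> oU cf oW; rewrite openE => x [Ux Wfx]; apply: filterI.
  exact: open_nbhs_nbhs.
by apply: (cf x (mem_set Ux)); exact: open_nbhs_nbhs.
Qed.

Lemma chart_image_open (M : topologicalType) (E : tvsType R) (a : chart M E)
    (S : set M) : open S -> S `<=` chart_dom a -> open (a @` S).
Proof.
move=> oS Sa; rewrite openE => _ [x Sx <-].
have aax : (a @` chart_dom a) (a x) by exists x => //; exact: Sa.
have ax : x \in chart_dom a by apply/mem_set/Sa.
have nS : nbhs (a x) (chart_inv a @^-1` S).
  apply: (chart_inv_continuous (mem_set aax)); rewrite /= chart_mapK //.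
  exact: open_nbhs_nbhs.
have nd : nbhs (a x) (a @` chart_dom a).
  by apply: open_nbhs_nbhs; split => //; exact: chart_im_open.
apply: filterS (filterI nS nd) => z [/= Sz [y ay ayz]]; exists y => //.
by move: Sz; rewrite -ayz chart_mapK ?inE.
Qed.

Lemma chart_preimage_open (M N : topologicalType) (E F : tvsType R)
    (a : chart M E) (b : chart N F) (U : set M) (f : M -> N) :
  open U -> {in U, continuous f} ->
  open (a @` (chart_dom a `&` U `&` f @^-1` chart_dom b)).
Proof.
move=> oU cf; apply: chart_image_open; last by move=> x [[]].
apply: open_in_preimage; last exact: chart_dom_open.
  by apply: openI => //; exact: chart_dom_open.
by move=> x /set_mem[_ Ux]; exact/cf/mem_set.
Qed.

Context (M N P : topologicalType) (E F Z : tvsType R)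
  (A : set (chart M E)) (B : set (chart N F)) (C : set (chart P Z)).

Lemma smooth_on_sub (U W : set M) (f : M -> N) :
  W `<=` U -> smooth_on A B U f -> smooth_on A B W f.
Proof.
move=> WU [cf sf]; split; first by move=> x /set_mem/WU/mem_set/cf.
move=> a b Aa Bb n; apply: Cn_on_sub (sf a b Aa Bb n).
by apply: image_subset => x [[ax /WU Ux] bx].
Qed.

Lemma smooth_on_eq (U : set M) (f g : M -> N) :
  open U -> (forall x, U x -> f x = g x) ->
  smooth_on A B U f -> smooth_on A B U g.
Proof.
move=> oU fg [cf sf].
have cg : {in U, continuous g}.
  move=> x xU; have Ux := set_mem xU; rewrite /= /continuous_at -fg //.
  apply: near_cvg (cf x xU).
  by apply: filterS (open_nbhs_nbhs (conj oU Ux)) => y /fg.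
split=> // a b Aa Bb n.
apply: (@Cn_on_eq _ n _ _ _ (b \o f \o chart_inv a)).
- exact: chart_preimage_open.
- move=> _ [x [[ax Ux] bx] <-].
  by rewrite /= chart_mapK ?inE //= fg.
- apply: Cn_on_sub (sf a b Aa Bb n).
  by move=> _ [x [[ax Ux] bx] <-]; exists x => //; split => //=; rewrite fg.
Qed.

Lemma smooth_on_local (U : set M) (f : M -> N) :
  hausdorff_space F -> open U ->
  (forall x, U x -> exists W, [/\ open W, W x & smooth_on A B W f]) ->
  smooth_on A B U f.
Proof.
move=> hF oU loc.
have cf : {in U, continuous f}.
  move=> x /set_mem/loc[W [oW Wx [+ _]]]; apply; exact: mem_set.
split=> // a b Aa Bb n; apply: Cn_on_local => //.
  exact: chart_preimage_open.
move=> _ [x [[ax Ux] bx] <-].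
have [W [oW Wx [cW sW]]] := loc x Ux.
exists (a @` (chart_dom a `&` W `&` f @^-1` chart_dom b)); split.
- exact: chart_preimage_open.
- by exists x.
- exact: sW.
Qed.

(** No single chart of [N] need contain the image of [f]. As the C^n property is local, a chart
    around [f x] can be inserted for each [x] separately. *)
Lemma smooth_on_comp (U : set M) (W : set N) (f : M -> N) (g : N -> P) :
  (forall y, exists2 b, B b & chart_dom b y) -> hausdorff_space Z ->
  open U -> open W -> (forall x, U x -> W (f x)) ->
  smooth_on A B U f -> smooth_on B C W g -> smooth_on A C U (g \o f).
Proof.
move=> coverB hZ oU oW UW [cf sf] [cg sg].
have cgf : {in U, continuous (g \o f)}.
  move=> x xU; apply: continuous_comp; first exact: cf.
  by apply: cg; apply/mem_set/UW/set_mem.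
split=> // a c Aa Cc n; apply: Cn_on_local => //.
  exact: chart_preimage_open.
move=> _ [x [[ax Ux] cx] <-].
have [b Bb bx] := coverB (f x).
pose S := chart_dom a `&` U `&` f @^-1` (W `&` g @^-1` chart_dom c `&` chart_dom b).
have oS : open S.
  apply: open_in_preimage.
  - by apply: openI => //; exact: chart_dom_open.
  - by move=> y /set_mem[_ Uy]; exact/cf/mem_set.
  - apply: openI; last exact: chart_dom_open.
    by apply: open_in_preimage => //; exact: chart_dom_open.
have Sa : S `<=` chart_dom a by move=> y [[]].
have oaS := chart_image_open oS Sa.
exists (a @` S); split=> //.
  by exists x => //; split => //; split => //; split => //; exact: UW.
apply: (@Cn_on_eq _ n _ _ _ ((c \o g \o chart_inv b) \o (b \o f \o chart_inv a))).
- by [].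
- move=> _ [y [[ay Uy] [_ bfy]] <-].
  by rewrite /= !chart_mapK ?inE //= chart_mapK ?inE.
apply: (Cn_on_comp oaS (W := b @` (chart_dom b `&` W `&` g @^-1` chart_dom c))).
- exact: chart_preimage_open.
- move=> _ [y [[ay Uy] [[Wy cgy] bfy]] <-] /=; rewrite chart_mapK ?inE //.
  by exists (f y).
- apply: Cn_on_sub (sf a b Aa Bb n).
  by move=> _ [y [[ay Uy] [_ bfy]] <-]; exists y.
- exact: sg.
Qed.

Lemma smooth_on_cst (U : set M) (y : N) : smooth_on A B U (fun=> y).
Proof.
split; first by move=> x _; exact: cvg_cst.
by move=> a b Aa Bb n; exact: Cn_on_cst.
Qed.

Lemma smooth_on_id (U : set M) : atlas A -> smooth_on A A U id.
Proof.
move=> [_ compat]; split; first by move=> x _; exact: cvg_id.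
move=> a b Aa Ab n; apply: Cn_on_sub (compat a b Aa Ab n).
by move=> _ [x [[ax _] bx] <-]; exists x.
Qed.

Lemma smooth_on_pair (U : set M) (f : M -> N) (g : M -> P) :
  open U -> smooth_on A B U f -> smooth_on A C U g ->
  smooth_on A (prod_atlas B C) U (fun x => (f x, g x) : (N * P)%type).
Proof.
move=> oU [cf sf] [cg sg].
have cfg : {in U, continuous (fun x => (f x, g x))}.
  by move=> x xU; apply: cvg_pairP; [exact: cf|exact: cg].
split=> // a _ Aa [b [c [Bb Cc ->]]] n.
apply: Cn_on_pair.
  apply: Cn_on_sub (sf a b Aa Bb n).
  by move=> _ [x [[ax Ux] [bx cx]] <-]; exists x.
apply: Cn_on_sub (sg a c Aa Cc n).
by move=> _ [x [[ax Ux] [bx cx]] <-]; exists x.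
Qed.

Lemma prod_atlas_cover :
  (forall y, exists2 b, B b & chart_dom b y) ->
  (forall z, exists2 c, C c & chart_dom c z) ->
  forall p : N * P, exists2 d, prod_atlas B C d & chart_dom d p.
Proof.
move=> cB cC [y z]; have [b Bb by_] := cB y; have [c Cc cz] := cC z.
by exists (prod_chart b c) => //; exists b, c.
Qed.

Lemma model_atlas_cover (y : E) :
  exists2 b, model_atlas E b & chart_dom b y.
Proof. by exists (model_chart E). Qed.

Lemma smooth_on_model (U : set E) (f : E -> F) :
  smooth_on (model_atlas E) (model_atlas F) U f <->
  {in U, continuous f} /\ Cinfty_on U f.
Proof.
have e : id @` ([set: E] `&` U `&` f @^-1` [set: F]) = U.
  by rewrite image_id preimage_setT setIT setTI.
split=> [[cf sf]|[cf sf]]; split=> //.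
  by have := sf (model_chart E) (model_chart F) erefl erefl; rewrite /= e.
by move=> _ _ -> -> /=; rewrite e.
Qed.

Lemma Cinfty_smooth_on (U : set E) (f : E -> F) :
  Cinfty_on U f -> smooth_on (model_atlas E) (model_atlas F) U f.
Proof.
by move=> Cf; apply/smooth_on_model; split=> //; exact: (Cn_on_continuous (Cf 0%N)).
Qed.

Lemma smooth_on_Cinfty (U : set E) (f : E -> F) :
  smooth_on (model_atlas E) (model_atlas F) U f -> Cinfty_on U f.
Proof. by move/smooth_on_model => []. Qed.

End SmoothMaps.

(** * Locally exponential groups *)

Section LogChart.
Context {R : realType} (E : tvsType R) (G : preTopologicalGroupType).
Variable AG : set (chart G E).

(** Local exponentiality in the form used below: the logarithm [l] itself serves as the chart at the
    identity. *)
Record log_chart (e : E -> G) (U : set E) (l : G -> E) : Prop := LogChart {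
  log_chart_lie : lie_group AG;
  log_chart_smooth : smooth (model_atlas E) AG e;
  log_chart_expD : forall (x : E) (s t : R),
    e ((s + t) *: x) = (e (s *: x) * e (t *: x))%g;
  log_chart_open : open U;
  log_chart0 : U 0;
  log_chart_im : open (e @` U);
  log_chartK : forall x, U x -> l (e x) = x;
  log_chart_log : smooth_on AG (model_atlas E) (e @` U) l }.

Lemma locally_exponential_log_chart : locally_exponential AG ->
  exists e U l, log_chart e U l.
Proof.
move=> [lieG [c [e [Ac c1 [se eD _] [U [l [[oU U0] oeU eK _ sl]]]]]]].
by exists e, U, l; split=> // x Ux; apply: eK; exact: mem_set.
Qed.

Variables (e : E -> G) (U : set E) (l : G -> E).
Hypothesis L : log_chart e U l.

Let lieG := log_chart_lie L.
Let hE := lie_group_model_hausdorff lieG.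
Let coverG := (lie_group_atlas lieG).1.

Lemma log_chart_nbhs0 : nbhs 0 U.
Proof.
by apply: open_nbhs_nbhs; split; [exact: log_chart_open L|exact: log_chart0 L].
Qed.

Lemma exp_continuous : continuous e.
Proof. by move=> x; apply: (log_chart_smooth L).1; rewrite inE. Qed.

Lemma mulg_continuous : continuous (fun p : G * G => (p.1 * p.2)%g).
Proof. by move=> x; apply: (lie_group_mul lieG).1; rewrite inE. Qed.

Lemma invg_continuous : continuous (fun x : G => (x^-1)%g).
Proof. by move=> x; apply: (lie_group_inv lieG).1; rewrite inE. Qed.

Lemma exp0 : e 0 = 1%g.
Proof.
have := log_chart_expD L 0 0 0; rewrite addr0 scale0r => e00.
by apply: (@mulgI _ (e 0)); rewrite mulg1.
Qed.

Lemma expN (x : E) : e (- x) = (e x)^-1%g.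
Proof.
have := log_chart_expD L x 1 (-1); rewrite subrr scale0r scale1r scaleN1r exp0.
by move=> e1; apply: (@mulgI _ (e x)); rewrite -e1 mulgV.
Qed.

Lemma log1 : l 1%g = 0.
Proof. by rewrite -exp0 (log_chartK L) //; exact: log_chart0 L. Qed.

Lemma im_log_chart1 : (e @` U) 1%g.
Proof. by exists 0; [exact: log_chart0 L|exact: exp0]. Qed.

Lemma log_continuous : {in e @` U, continuous l}.
Proof. exact: (log_chart_log L).1. Qed.

Lemma logK (g : G) : (e @` U) g -> e (l g) = g.
Proof. by move=> [x Ux <-]; rewrite (log_chartK L). Qed.

Lemma log_chart_inj (x y : E) : U x -> U y -> e x = e y -> x = y.
Proof. by move=> Ux Uy exy; rewrite -(log_chartK L Ux) exy (log_chartK L). Qed.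

Lemma log_chart_image_open (W : set E) : open W -> W `<=` U -> open (e @` W).
Proof.
move=> oW WU.
suff -> : e @` W = e @` U `&` l @^-1` W.
  by apply: open_in_preimage => //; [exact: log_chart_im L|exact: log_continuous].
apply/seteqP; split=> [_ [x Wx <-]|_ [[x Ux <-] /=]].
  by split; [exists x => //; exact: WU|rewrite /= (log_chartK L) //; exact: WU].
by rewrite (log_chartK L) // => Wx; exists x.
Qed.

(** The group product in logarithmic coordinates, which Lie theory expands as the
    Baker-Campbell-Hausdorff series. *)
Definition log_mul (p : E * E) : E := l (e p.1 * e p.2)%g.

(** Only the product has to be close to 1, not the factors; thus [(- x, x)] belongs to the domain
    for every [x]. *)
Definition log_mul_dom : set (E * E) := [set p | (e @` U) (e p.1 * e p.2)%g].

Let exp_mul_smooth :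
  smooth_on (model_atlas (E * E)%type) AG setT
    (fun p : E * E => (e p.1 * e p.2)%g).
Proof.
have sfst (f : E * E -> E) : Cinfty_on setT f ->
    smooth_on (model_atlas (E * E)%type) AG setT (e \o f).
  move=> Cf; apply: (@smooth_on_comp _ _ _ _ _ _ _ _ (model_atlas E) _ _ setT).
  - exact: model_atlas_cover.
  - exact: hE.
  - exact: openT.
  - exact: openT.
  - by [].
  - exact: Cinfty_smooth_on.
  - exact: log_chart_smooth L.
have := @smooth_on_comp _ _ _ _ _ _ _ (model_atlas (E * E)%type)
  (prod_atlas AG AG) AG setT setT (fun p : E * E => (e p.1, e p.2))
  (fun p : G * G => (p.1 * p.2)%g).
apply=> //; try exact: openT; try exact: hE.
- exact: prod_atlas_cover.
- apply: smooth_on_pair; first exact: openT.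
    by apply: (sfst fst) => n; exact: Cn_on_fst.
  by apply: (sfst snd) => n; exact: Cn_on_snd.
- exact: lie_group_mul lieG.
Qed.

Lemma open_log_mul_dom : open log_mul_dom.
Proof.
have -> : log_mul_dom = setT `&` (fun p : E * E => (e p.1 * e p.2)%g) @^-1` (e @` U).
  by rewrite setTI.
apply: open_in_preimage; [exact: openT|exact: exp_mul_smooth.1|exact: log_chart_im L].
Qed.

Lemma log_mul_Cinfty : Cinfty_on log_mul_dom log_mul.
Proof.
apply: smooth_on_Cinfty.
apply: (@smooth_on_comp _ _ _ _ _ _ _ _ AG _ _ (e @` U)
  (fun p : E * E => (e p.1 * e p.2)%g) l) => //; try exact: hE.
- exact: open_log_mul_dom.
- exact: log_chart_im L.
- by apply: smooth_on_sub exp_mul_smooth.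
- exact: log_chart_log L.
Qed.

Lemma log_mul_dom0 : log_mul_dom (0, 0).
Proof. by rewrite /log_mul_dom /= exp0 mulg1; exact: im_log_chart1. Qed.

Lemma lmul_smooth (k : G) : smooth AG AG (fun x => (k * x)%g).
Proof.
have := @smooth_on_comp _ _ _ _ _ _ _ AG
  (prod_atlas AG AG) AG setT setT (fun x : G => (k, x))
  (fun p : G * G => (p.1 * p.2)%g).
apply=> //; try exact: openT; try exact: hE.
- exact: prod_atlas_cover.
- apply: smooth_on_pair; first exact: openT.
    exact: smooth_on_cst.
  by apply: smooth_on_id; exact: lie_group_atlas lieG.
- exact: lie_group_mul lieG.
Qed.

Lemma lmul_preimage_open (k : G) (O : set G) :
  open O -> open [set x | O (k * x)%g].
Proof.
move=> oO; have -> : [set x | O (k * x)%g] = setT `&` (fun x => (k * x)%g) @^-1` O.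
  by rewrite setTI.
by apply: open_in_preimage; [exact: openT|exact: (lmul_smooth k).1|].
Qed.

Lemma log_lmul_smooth (k : G) :
  smooth_on AG (model_atlas E) [set x | (e @` U) (k * x)%g]
    (fun x => l (k * x)%g).
Proof.
apply: (@smooth_on_comp _ _ _ _ _ _ _ _ AG _ _ (e @` U) (fun x => (k * x)%g) l)
  => //; try exact: hE.
- by apply: lmul_preimage_open; exact: log_chart_im L.
- exact: log_chart_im L.
- exact: smooth_on_sub (lmul_smooth k).
- exact: log_chart_log L.
Qed.

(** The differential at [(0, 0)] is linear, hence the sum of its two partial differentials. Both are
    the identity because one factor is then 1. *)
Lemma log_mul_derive0 (x y : E) :
  t^-1 *: log_mul (t *: x, t *: y) @[t --> (0 : R)^'] --> x + y.
Proof.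
have [dm [dmP Cdm]] := Cinfty_deriv hE open_log_mul_dom log_mul_Cinfty.
have C1 := C1_deriv_Cn dmP (Cdm 0%N).
have D0 := log_mul_dom0.
have lin := deriv_linear hE open_log_mul_dom C1 D0.
have m0 : log_mul (0, 0) = 0 by rewrite /log_mul /= exp0 mulg1 log1.
have Unear (z : E) : \forall t \near (0 : R)^', U (t *: z).
  have Uz := @line_cvg _ E 0 z U log_chart_nbhs0.
  by near=> t; rewrite -[t *: z]add0r; near: t; exact: Uz.
have dx (z : E) : dm ((0, 0), (z, 0)) = z.
  apply: (dir_derive_unique hE (dmP (0, 0) (z, 0) D0)).
  have : (fun=> z) @ (0 : R)^' --> z by exact: cvg_cst.
  apply: near_cvg; near=> t.
  have t0 : t != 0 by near: t; exact: nbhs_dnbhs_neq.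
  rewrite m0 subr0 /log_mul /= scaler0 !add0r exp0 mulg1 (log_chartK L).
    by rewrite scalerA mulVf // scale1r.
  by near: t; exact: Unear.
have dy (z : E) : dm ((0, 0), (0, z)) = z.
  apply: (dir_derive_unique hE (dmP (0, 0) (0, z) D0)).
  have : (fun=> z) @ (0 : R)^' --> z by exact: cvg_cst.
  apply: near_cvg; near=> t.
  have t0 : t != 0 by near: t; exact: nbhs_dnbhs_neq.
  rewrite m0 subr0 /log_mul /= scaler0 !add0r exp0 mul1g (log_chartK L).
    by rewrite scalerA mulVf // scale1r.
  by near: t; exact: Unear.
have := dmP (0, 0) (x, y) D0.
have -> : dm ((0, 0), (x, y)) = x + y.
  have := lin 1 (x, 0) (0, y); rewrite !scale1r dx dy => <-.
  by congr (dm (_, (_, _))); rewrite ?addr0 ?add0r.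
rewrite /is_dir_derive m0; apply: near_cvg; near=> t.
by rewrite subr0; congr (_ *: log_mul (_, _)); rewrite /= add0r.
Unshelve. all: by end_near. Qed.

End LogChart.

(** * One-parameter subgroups and the dense embedding *)

Section OneParameter.
Context {R : realType} (E : tvsType R) (G : preTopologicalGroupType).
Context (AG : set (chart G E)) (e : E -> G) (U : set E) (l : G -> E).
Hypothesis L : log_chart AG e U l.

Let hG := lie_group_hausdorff (log_chart_lie L).

Lemma small_scale (W : set E) (x : E) : nbhs 0 W ->
  \forall t \near (0 : R)^', W (t *: x).
Proof.
move=> W0; have Wx := @line_cvg _ E 0 x W W0.
by near=> t; rewrite -[t *: x]add0r; near: t; exact: Wx.
Unshelve. all: by end_near. Qed.

(** A small nonzero [t] brings both vectors into [U], where [e] is injective. *)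
Lemma one_parameter_inj (x y : E) : (forall t : R, e (t *: x) = e (t *: y)) -> x = y.
Proof.
move=> exy.
have nU := log_chart_nbhs0 L.
suff [t [t0 Ux Uy]] : exists t : R, [/\ t != 0, U (t *: x) & U (t *: y)].
  have := log_chart_inj L Ux Uy (exy t).
  by move=> /(congr1 ( *:%R t^-1)); rewrite !scalerA mulVf // !scale1r.
have : \forall t \near (0 : R)^', [/\ t != 0, U (t *: x) & U (t *: y)].
  near=> t; split; near: t; [exact: nbhs_dnbhs_neq|exact: small_scale..].
by move=> /filter_ex.
Unshelve. all: by end_near. Qed.

Section Homomorphism.
Variable a : R -> G.
Hypotheses (ca : continuous a) (aD : forall s t, a (s + t) = (a s * a t)%g).

(* Square roots are unique in [e @` K], so [l (a 2^-k) = 2^-k *: l (a 1)]; hence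
   the two one-parameter groups agree at dyadic times, and everywhere. *)
Lemma one_parameter_root (K : set E) :
  K `<=` U -> (forall x, K x -> U (2 *: x)) ->
  (forall t, 0 <= t <= 1 -> (e @` K) (a t)) ->
  forall t, a t = e (t *: l (a 1)).
Proof.
move=> KU K2 aK; set x := l (a 1).
have a0 : a 0 = 1%g by apply: (@mulgI _ (a 0)); rewrite -aD addr0 mulg1.
have eD (s t : R) : e ((s + t) *: x) = (e (s *: x) * e (t *: x))%g.
  exact: log_chart_expD L x s t.
have lK t : 0 <= t <= 1 -> K (l (a t)) /\ e (l (a t)) = a t.
  by move=> /aK[z Kz <-]; rewrite (log_chartK L) //; exact: KU.
have pow01 k : 0 <= (2^-1 ^+ k : R) <= 1.
  by rewrite exprn_ge0 ?invr_ge0 //= exprn_ile1 ?invr_ge0 // invf_le1 // ler1n.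
have xk k : l (a (2^-1 ^+ k)) = 2^-1 ^+ k *: x.
  elim: k => [|k IHk]; first by rewrite expr0 scale1r.
  set y := l (a (2^-1 ^+ k.+1)).
  have [Ky ey] := lK _ (pow01 k.+1).
  suff : 2 *: y = 2^-1 ^+ k *: x.
    move=> /(congr1 ( *:%R 2^-1)); rewrite !scalerA -exprS mulVf ?scale1r //.
  have [Kz ez] := lK _ (pow01 k).
  rewrite -IHk; apply: (log_chart_inj L); [exact: K2|exact: KU|].
  rewrite ez -[2]/(1 + 1) (log_chart_expD L) scale1r /y ey -aD.
  by congr a; rewrite exprS; field.
pose S t := a t = e (t *: x).
have SV t : S t -> S (- t).
  rewrite /S scaleNr (expN L) => <-; apply: (@mulgI _ (a t)).
  by rewrite -aD subrr a0 mulgV.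
have Sn n t : S t -> S (n%:R * t).
  move=> St; elim: n => [|n IHn]; first by rewrite /S mul0r scale0r a0 (exp0 L).
  by rewrite /S -natr1 mulrDl mul1r aD IHn St -eD.
have Sk k : S (2^-1 ^+ k).
  by have [_ ek] := lK _ (pow01 k); rewrite /S -ek xk.
suff Spos t : 0 <= t -> S t.
  move=> t; have [/Spos //|/ltW t0] := leP 0 t.
  by rewrite -[t]opprK; apply/SV/Spos; rewrite oppr_ge0.
move=> t0.
(* Dyadic approximation of [t] from below; [Sn] and [Sk] apply to it. *)
pose u k : R := (Num.truncn (t * 2 ^+ k))%:R * 2^-1 ^+ k.
have ut : u @ \oo --> t.
  apply/cvgrPdist_le => d d0.
  have := @cvg_expr R 2^-1; rewrite ger0_norm ?invr_ge0 // invf_lt1 // ltr1n.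
  move=> /(_ erefl)/cvgrPdist_le/(_ d d0); apply: filterS => k.
  rewrite sub0r normrN ger0_norm ?exprn_ge0 ?invr_ge0 //; apply: le_trans.
  have p0 : 0 < 2 ^+ k :> R by rewrite exprn_gt0.
  have -> : t - u k = (t * 2 ^+ k - (Num.truncn (t * 2 ^+ k))%:R) * 2^-1 ^+ k.
    by rewrite /u mulrBl -(mulrA t) -exprMn divff ?expr1n ?mulr1.
  have /andP[lo hi] := truncn_itv (mulr_ge0 t0 (ltW p0)).
  rewrite ger0_norm; last first.
    by rewrite mulr_ge0 ?subr_ge0 // exprn_ge0 // invr_ge0.
  rewrite ler_piMl // ?exprn_ge0 ?invr_ge0 // lerBlDr.
  by rewrite (le_trans (ltW hi)) // -natr1 addrC.
have au : a (u k) @[k --> \oo] --> a t by apply: cvg_comp ut _; exact: ca.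
have eu : e (u k *: x) @[k --> \oo] --> e (t *: x).
  have ux : u k *: x @[k --> \oo] --> t *: x.
    by apply: tvs_cvgZ; [exact: ut|exact: cvg_cst].
  by apply: cvg_comp ux _; exact: (exp_continuous L).
apply: (cvg_unique hG au).
by move: eu; apply: near_cvg; near=> k; rewrite -(Sn _ _ (Sk k)).
Unshelve. all: by end_near. Qed.

End Homomorphism.

(** As doubling does not leave [U], [e (2 *: x)] determines [x] in [K]: square roots are unique in
    the image of [K] under [e]. *)
Lemma square_root_domain : exists K : set E,
  [/\ open K, K 0, K `<=` U, (forall x, K x -> U (2 *: x)) & convex_subset K].
Proof.
have nU := log_chart_nbhs0 L.
have c2 : (fun x : E => 2 *: x) @ nbhs 0 --> (2 *: 0 : E).
  by apply: tvs_cvgZ; [exact: cvg_cst|exact: cvg_id].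
have n2 : nbhs (0 : E) [set x | U (2 *: x)] by apply: c2; rewrite scaler0.
have [K [oK K0 cK KU]] := convex_open_nbhs (filterI nU n2).
by exists K; split=> // x /KU[].
Qed.

Lemma one_parameter_exists (a : R -> G) : continuous a ->
  (forall s t, a (s + t) = (a s * a t)%g) ->
  exists x, forall t, a t = e (t *: x).
Proof.
move=> ca aD.
have [K [oK K0 KU K2 _]] := square_root_domain.
have a0 : a 0 = 1%g by apply: (@mulgI _ (a 0)); rewrite -aD addr0 mulg1.
have neK : nbhs (a 0) (e @` K).
  apply: open_nbhs_nbhs; split; first exact: log_chart_image_open L _ oK KU.
  by rewrite a0; exists 0 => //; exact: exp0 L.
have [d /= d0 dK] := ca 0 _ neK.
have dd : 0 < d / 2 by rewrite divr_gt0.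
(* Time is slowed down so that [0, 1] is mapped into the domain of unique square roots. The factor
   is [d / 2] because the ball of radius [d] is open whereas [0, 1] contains 1. *)
pose b t := a (t * (d / 2)).
have cb : continuous b.
  move=> t; have ct : (fun t => t * (d / 2)) @ t --> t * (d / 2).
    by apply: cvgM; [exact: cvg_id|exact: cvg_cst].
  exact: cvg_comp ct (@ca (t * (d / 2))).
have bD s t : b (s + t) = (b s * b t)%g by rewrite /b mulrDl aD.
have bK t : 0 <= t <= 1 -> (e @` K) (b t).
  move=> /andP[t0 t1]; apply: dK; rewrite /= sub0r normrN ger0_norm.
    apply: (@le_lt_trans _ _ (d / 2)); first by rewrite ler_piMl // ltW.
    by rewrite ltr_pdivrMr // ltr_pMr // ltr1n.
  by rewrite mulr_ge0 // ltW.
have bE := one_parameter_root cb bD KU K2 bK.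
exists ((d / 2)^-1 *: l (b 1)) => t.
rewrite scalerA -bE /b; congr a.
by rewrite mulfVK // gt_eqF.
Qed.

End OneParameter.

(** The inclusion of the dense subgroup, freed from the subtype; [embedding_initial] says that [K]
    has the topology induced from [G]. *)
Record dense_embedding (K G : preTopologicalGroupType) (i : K -> G) : Prop :=
  DenseEmbedding {
    embeddingM : forall x y, i (x * y)%g = (i x * i y)%g;
    embedding_inj : injective i;
    embedding_continuous : continuous i;
    embedding_initial : forall O : set K, open O ->
      exists2 Q' : set G, open Q' & O = i @^-1` Q';
    embedding_dense : dense (range i) }.

(** * The Lie algebra morphism of a dense embedding *)

Section LieMorphism.
Context {R : realType} (E F : tvsType R) (G K : preTopologicalGroupType).
Context (AG : set (chart G E)) (e : E -> G) (U : set E) (l : G -> E).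
Context (AK : set (chart K F)) (eK : F -> K) (UK : set F) (lK : K -> F).
Hypotheses (L : log_chart AG e U l) (LK : log_chart AK eK UK lK).
Context (i : K -> G).
Hypothesis I : dense_embedding i.

Let hE := lie_group_model_hausdorff (log_chart_lie L).

Lemma embedding1 : i 1%g = 1%g.
Proof. by apply: (@mulgI _ (i 1%g)); rewrite -(embeddingM I) !mulg1. Qed.

Let b (y : F) (t : R) : G := i (eK (t *: y)).

Let b_continuous y : continuous (b y).
Proof.
move=> t; have ct : (fun s : R => s *: y) @ t --> t *: y.
  by apply: tvs_cvgZ; [exact: cvg_id|exact: cvg_cst].
have ce : (fun s : R => eK (s *: y)) @ t --> eK (t *: y).
  exact: cvg_comp ct (@exp_continuous _ _ _ _ _ _ _ LK (t *: y)).
exact: cvg_comp ce (@embedding_continuous _ _ _ I _).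
Qed.

Let bD y s t : b y (s + t) = (b y s * b y t)%g.
Proof. by rewrite /b (log_chart_expD LK) (embeddingM I). Qed.

Lemma exists_lie_morphism : exists phi : F -> E,
  forall y t, i (eK (t *: y)) = e (t *: phi y).
Proof.
have /choice[phi phiP] : forall y, exists x, forall t, b y t = e (t *: x).
  by move=> y; apply: (one_parameter_exists L); [exact: b_continuous|exact: bD].
by exists phi.
Qed.

Variable phi : F -> E.
Hypothesis phiP : forall y (t : R), i (eK (t *: y)) = e (t *: phi y).

Lemma lie_morphism_exp y : i (eK y) = e (phi y).
Proof. by have := phiP y 1; rewrite !scale1r. Qed.

Lemma lie_morphismZ s y : phi (s *: y) = s *: phi y.
Proof.
apply: (one_parameter_inj L) => t.
by rewrite -phiP !scalerA -phiP.
Qed.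

(** The value of a one-parameter group at time 1 determines its velocity only if the group stays
    among unique square roots during [0, 1]. A convex neighbourhood of 0 contains the whole segment
    from 0 to [y] and so guarantees this. *)
Lemma lie_morphism_log : exists O : set F, [/\ open O, O 0 &
  forall y, O y -> U (phi y) /\ phi y = l (i (eK y))].
Proof.
have [C [oC C0 CU C2 cC]] := square_root_domain L.
have oeC := log_chart_image_open L oC CU.
have ci : i (eK y) @[y --> (0 : F)] --> i (eK 0).
  exact: cvg_comp (@exp_continuous _ _ _ _ _ _ _ LK 0)
    (@embedding_continuous _ _ _ I _).
have neC : nbhs (i (eK 0)) (e @` C).
  apply: open_nbhs_nbhs; split => //.
  by rewrite (exp0 LK) embedding1; exists 0 => //; exact: exp0 L.
have [Q [oQ Q0 cQ QC]] := convex_open_nbhs (ci _ neC).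
exists Q; split=> // y Qy.
have bC t : 0 <= t <= 1 -> (e @` C) (b y t).
  by move=> t01; apply: QC; exact: convex_subset0.
have bE := one_parameter_root L (@b_continuous y) (bD y) CU C2 bC.
have phiE : phi y = l (i (eK y)).
  apply: (one_parameter_inj L) => t.
  by have bt := bE t; rewrite -phiP -/(b y t) bt /b scale1r.
split=> //; rewrite phiE.
have [z Cz ez] := QC _ Qy.
by rewrite -ez (log_chartK L); [exact: CU|exact: CU].
Qed.

(** The logarithmic formula gives continuity near 0, and homogeneity carries it to every point.
    Additivity is not yet available: its proof relies on this continuity. *)
Lemma lie_morphism_continuous : continuous phi.
Proof.
have [Q [oQ Q0 Qphi]] := lie_morphism_log.
have cQ y : Q y -> phi z @[z --> y] --> phi y.
  move=> Qy; have [Uy ey] := Qphi y Qy.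
  have ci : i (eK z) @[z --> y] --> i (eK y).
    exact: cvg_comp (@exp_continuous _ _ _ _ _ _ _ LK y)
      (@embedding_continuous _ _ _ I _).
  have ieU : i (eK y) \in e @` U.
    by apply/mem_set; exists (phi y) => //; rewrite lie_morphism_exp.
  have cl := cvg_comp _ _ ci (log_continuous L ieU).
  move: cl.
  rewrite ey; apply: near_cvg.
  by apply: filterS (open_nbhs_nbhs (conj oQ Qy)) => z /Qphi[_ ->].
move=> y.
have [t [t0 Qty]] : exists t : R, t != 0 /\ Q (t *: y).
  have : \forall t \near (0 : R)^', t != 0 /\ Q (t *: y).
    near=> t; split; near: t; first exact: nbhs_dnbhs_neq.
    by apply: small_scale; exact: open_nbhs_nbhs.
  by move=> /filter_ex.
have ct : t *: z @[z --> y] --> t *: y.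
  by apply: tvs_cvgZ; [exact: cvg_cst|exact: cvg_id].
have cphi : phi (t *: z) @[z --> y] --> phi (t *: y).
  exact: cvg_comp ct (cQ _ Qty).
have : t^-1 *: phi (t *: z) @[z --> y] --> t^-1 *: phi (t *: y).
  by apply: tvs_cvgZ cphi; exact: cvg_cst.
rewrite lie_morphismZ scalerA mulVf // scale1r; apply: near_cvg; near=> z.
by rewrite lie_morphismZ scalerA mulVf // scale1r.
Unshelve. all: by end_near. Qed.

(* [x + y] is the derivative at 0 of [t |-> log (exp (t x) exp (t y))], an
   expression preserved by [phi] for small [t]. *)
Lemma lie_morphismD x y : phi (x + y) = phi x + phi y.
Proof.
have nU := log_chart_nbhs0 L.
have cxy := @log_mul_derive0 _ _ _ _ _ _ _ LK x y.
have c1 := cvg_comp _ _ cxy (@lie_morphism_continuous _).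
have c2 := @log_mul_derive0 _ _ _ _ _ _ _ L (phi x) (phi y).
apply: (cvg_unique hE c1); apply: near_cvg c2.
have phi0 : phi 0 = 0 by rewrite -[X in phi X](scale0r (0 : F)) lie_morphismZ scale0r.
have small : log_mul eK lK (t *: x, t *: y) @[t --> (0 : R)^'] --> (0 : F).
  have ct : t @[t --> (0 : R)^'] --> (0 : R) by exact: cvg_within.
  have : t *: (t^-1 *: log_mul eK lK (t *: x, t *: y)) @[t --> (0 : R)^']
      --> 0 *: (x + y) by exact: tvs_cvgZ.
  rewrite scale0r; apply: near_cvg; near=> t.
  have t0 : t != 0 by near: t; exact: nbhs_dnbhs_neq.
  by rewrite scalerA mulfV // scale1r.
have inU : \forall t \near (0 : R)^', U (phi (log_mul eK lK (t *: x, t *: y))).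
  have nphi : nbhs (0 : F) (phi @^-1` U).
    by apply: lie_morphism_continuous; rewrite phi0.
  exact: (small _ nphi).
have inD : \forall t \near (0 : R)^', log_mul_dom eK UK (t *: x, t *: y).
  have sc (z : F) : t *: z @[t --> (0 : R)^'] --> (0 : F).
    by move=> W W0; exact: (@small_scale _ _ W z W0).
  have cxy0 : (t *: x, t *: y) @[t --> (0 : R)^'] --> ((0, 0) : F * F).
    by apply: cvg_pairP; exact: sc.
  have nD : nbhs ((0, 0) : F * F) (log_mul_dom eK UK).
    apply: open_nbhs_nbhs; split; first exact: open_log_mul_dom LK.
    exact: log_mul_dom0 LK.
  exact: (cxy0 _ nD).
near=> t.
rewrite /= lie_morphismZ; congr (_ *: _).
rewrite -[RHS](log_chartK L); last by near: t; exact: inU.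
rewrite -lie_morphism_exp (logK LK); last by near: t; exact: inD.
by rewrite (embeddingM I) !phiP.
Unshelve. all: by end_near. Qed.

Lemma lie_morphism_linear : linear phi.
Proof. by move=> a x y; rewrite lie_morphismD lie_morphismZ. Qed.

Lemma lie_morphism0 : phi 0 = 0.
Proof. by rewrite -[X in phi X](scale0r (0 : F)) lie_morphismZ scale0r. Qed.

Lemma lie_morphism_inj : injective phi.
Proof.
move=> x y exy; apply: (one_parameter_inj LK) => t.
by apply: (embedding_inj I); rewrite !phiP exy.
Qed.

(** The exponentials of a small [S] form an open set of [K], which is the trace of an open set [Q']
    of [G]; its preimage under [e] is the neighbourhood sought. Intersecting with [U] lets
    injectivity of [e] identify [y] with an element of [S]. *)
Lemma lie_morphism_embedding (W : set F) : nbhs 0 W ->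
  exists2 W' : set E, nbhs 0 W' & forall y, W' (phi y) -> W y.
Proof.
have nU := log_chart_nbhs0 L.
have nUK := log_chart_nbhs0 LK.
have nphi : nbhs (0 : F) (phi @^-1` U).
  by apply: lie_morphism_continuous; rewrite lie_morphism0.
move=> W0; have [S [oS S0 _ SW]] := convex_open_nbhs (filterI W0 (filterI nUK nphi)).
have oeS : open (eK @` S).
  by apply: log_chart_image_open LK _ oS _ => y /SW[_ []].
have [Q' oQ' eQ'] := embedding_initial I oeS.
exists (U `&` e @^-1` Q').
  apply: filterI => //; apply: (exp_continuous L); apply: open_nbhs_nbhs; split=> //.
  rewrite (exp0 L) -embedding1 -(exp0 LK).
  have : (eK @` S) (eK 0) by exists 0.
  by rewrite eQ'.
move=> y [Uy Oy].
have : (eK @` S) (eK y) by rewrite eQ' /= lie_morphism_exp.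
move=> [w Sw ew]; have [Ww [_ Uw]] := SW _ Sw.
suff -> : y = w by [].
apply: lie_morphism_inj; apply: (log_chart_inj L) => //.
by rewrite -!lie_morphism_exp ew.
Qed.

(** A vector is scaled into [U], and its exponential is approximated by elements of the subgroup.
    Such an element might not be the exponential of a small vector of [F]; keeping it in [Q'], whose
    trace on [K] is the image of [S] under [eK], ensures that it is. The result is then scaled
    back. *)
Lemma lie_morphism_dense : dense (range phi).
Proof.
have nUK := log_chart_nbhs0 LK.
have oU := log_chart_open L.
have nU := log_chart_nbhs0 L.
have nphi : nbhs (0 : F) (phi @^-1` U).
  by apply: lie_morphism_continuous; rewrite lie_morphism0.
have [S [oS S0 _ SW]] := convex_open_nbhs (filterI nUK nphi).
have oeS : open (eK @` S).
  by apply: log_chart_image_open LK _ oS _ => y /SW[].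
have [Q' oQ' eQ'] := embedding_initial I oeS.
have nQ' : nbhs (0 : E) (e @^-1` Q').
  apply: (exp_continuous L); apply: open_nbhs_nbhs; split=> //.
  rewrite (exp0 L) -embedding1 -(exp0 LK).
  have : (eK @` S) (eK 0) by exists 0.
  by rewrite eQ'.
move=> W [x Wx] oW.
have [t [t0 Ux Qx]] : exists t : R, [/\ t != 0, U (t *: x) & Q' (e (t *: x))].
  have : \forall t \near (0 : R)^', [/\ t != 0, U (t *: x) & Q' (e (t *: x))].
    near=> t; split; near: t; first exact: nbhs_dnbhs_neq.
      exact: small_scale.
    exact: (@small_scale _ _ (e @^-1` Q')).
  by move=> /filter_ex.
pose W1 : set E := [set z | W (t^-1 *: z)].
have oW1 : open W1.
  rewrite openE => z W1z.
  have cz : t^-1 *: z' @[z' --> z] --> t^-1 *: z.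
    by apply: tvs_cvgZ; [exact: cvg_cst|exact: cvg_id].
  by apply: cz; exact: open_nbhs_nbhs.
have oeW : open (e @` (U `&` W1)).
  by apply: log_chart_image_open L _ (openI oU oW1) _ => z [].
have [_ [[[w [Uw W1w] <-] Ow] [k _ kw]]] :
    ((e @` (U `&` W1)) `&` Q') `&` range i !=set0.
  apply: (embedding_dense I); last exact: openI.
  exists (e (t *: x)); split=> //; exists (t *: x) => //; split => //.
  by rewrite /W1 /= scalerA mulVf // scale1r.
have : (eK @` S) k by rewrite eQ' /= kw.
move=> [y Sy eky]; have [_ Uy] := SW _ Sy.
exists (t^-1 *: w); split=> //.
exists (t^-1 *: y) => //; rewrite lie_morphismZ; congr (_ *: _).
by apply: (log_chart_inj L) => //; rewrite -lie_morphism_exp eky.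
Unshelve. all: by end_near. Qed.

(** Near [k], [i] is the left translation by [i k] of [e \o phi] applied to the logarithm of
    [k^-1 * x], and [phi] is linear and continuous. *)
Lemma embedding_smooth : smooth AK AG i.
Proof.
have oUK := log_chart_im LK.
apply: smooth_on_local => [||k _]; [exact: hE|exact: openT|].
exists [set x | (eK @` UK) (k^-1 * x)%g]; split.
- exact: (lmul_preimage_open LK).
- by rewrite /= mulVg; exact: im_log_chart1 LK.
have se : smooth_on (model_atlas F) AG setT (e \o phi).
  apply: (@smooth_on_comp _ _ _ _ _ _ _ _ (model_atlas E) _ _ setT).
  - exact: model_atlas_cover.
  - exact: hE.
  - exact: openT.
  - exact: openT.
  - by [].
  - apply: Cinfty_smooth_on => n.
    by apply: Cn_on_linear; [exact: lie_morphism_linear|exact: lie_morphism_continuous].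
  - exact: log_chart_smooth L.
have sel : smooth_on AK AG [set x | (eK @` UK) (k^-1 * x)%g]
    ((e \o phi) \o (fun x => lK (k^-1 * x)%g)).
  apply: (@smooth_on_comp _ _ _ _ _ _ _ _ (model_atlas F) _ _ setT).
  - exact: model_atlas_cover.
  - exact: hE.
  - exact: (lmul_preimage_open LK).
  - exact: openT.
  - by [].
  - exact: log_lmul_smooth LK _.
  - exact: se.
have := @smooth_on_comp _ _ _ _ _ _ _ AK AG AG _ setT _ (fun x => (i k * x)%g)
  (lie_group_atlas (log_chart_lie L)).1 hE (lmul_preimage_open LK _ oUK) openT
  (fun _ _ => Logic.I) sel (lmul_smooth L (i k)).
apply: smooth_on_eq; first exact: (lmul_preimage_open LK).
move=> x kx /=; rewrite -lie_morphism_exp (logK LK) // -(embeddingM I).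
by rewrite mulgA mulgV mul1g.
Qed.

End LieMorphism.

(** * Extension of unitary representations *)

Lemma dense_meet (X Y : topologicalType) (j : X -> Y) (y : Y) (N : set Y) :
  dense (range j) -> nbhs y N -> exists x, N (j x).
Proof.
move=> dj; rewrite nbhsE => -[W [oW Wy] WN].
have [z [Wz [x _ ex]]] := dj W (ex_intro _ y Wy) oW.
by exists x; apply: WN; rewrite ex.
Qed.

(** The Cauchy condition is imposed at each point of [Y] separately and uses no uniform structure on
    [Y]. This serves both orbit maps on the group and multilinear maps. *)
Lemma dense_extension (K : numFieldType) (V : completeNormedModType K)
    (X Y : topologicalType) (j : X -> Y) (f : X -> V) :
  dense (range j) ->
  (forall (y : Y) (eps : K), 0 < eps -> exists2 N : set Y, nbhs y N &
     forall x x', N (j x) -> N (j x') -> `|f x - f x'| < eps) ->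
  exists g : Y -> V, continuous g /\ forall x, g (j x) = f x.
Proof.
move=> dj cauchyf.
have meet (y : Y) (N : set Y) := @dense_meet _ _ j y N dj.
pose G (y : Y) : set_system V :=
  [set A | exists2 N : set Y, nbhs y N & forall x, N (j x) -> A (f x)].
have PG y : ProperFilter (G y).
  split; first by move=> [N /meet[x Nx]] /(_ x Nx).
  split; first by exists setT => //; exact: filterT.
    move=> A B [N yN NA] [M yM MB]; exists (N `&` M); first exact: filterI.
    by move=> x [/NA ? /MB].
  by move=> A B AB [N yN NA]; exists N => // x /NA/AB.
have /choice[g gP] : forall y, exists v : V, G y --> v.
  move=> y; apply/cvg_ex; apply: cauchy_cvg; apply: cauchy_exP => eps eps0.
  have [N yN Nf] := cauchyf y eps eps0; have [x Nx] := meet y N yN.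
  by exists (f x); exists N => // x' Nx'; rewrite -ball_normE /=; exact: Nf.
have gf y (eps : K) : 0 < eps -> exists N, [/\ open N, N y &
    forall y' x, N y' -> N (j x) -> `|g y' - f x| < eps].
  move=> eps0; have e2 : 0 < eps / 2 by rewrite divr_gt0.
  have [N' + N'f] := cauchyf y _ e2.
  rewrite nbhsE => -[N [oN Ny] NN']; exists N; split=> // y' x Ny' Nx.
  have nb : nbhs (g y') (ball (g y') (eps / 2)) by exact: nbhsx_ballx.
  have [M yM Mf] := gP y' _ nb.
  have [x' [Mx' Nx']] := meet y' _ (filterI yM (open_nbhs_nbhs (conj oN Ny'))).
  have := Mf x' Mx'; rewrite -ball_normE /= => gfx'.
  rewrite -(subrKA (f x')) (le_lt_trans (ler_normD _ _)) // [ltRHS]splitr.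
  by rewrite ltrD // N'f //; exact: NN'.
exists g; split.
  move=> y; apply/cvgrPdist_lt => eps eps0; have e2 : 0 < eps / 2 by rewrite divr_gt0.
  have [N [oN Ny Nf]] := gf y _ e2.
  apply: filterS (open_nbhs_nbhs (conj oN Ny)) => y' Ny'.
  have [x Nx] := meet y N (open_nbhs_nbhs (conj oN Ny)).
  rewrite -(subrKA (f x)) (le_lt_trans (ler_normD _ _)) // [ltRHS]splitr.
  by rewrite ltrD ?Nf // distrC Nf.
move=> x; apply/eqP; rewrite -subr_eq0 -normr_eq0; apply/eqP.
apply: le_anti; rewrite normr_ge0 andbT.
apply/ler_addgt0Pl => eps eps0; rewrite addr0.
have [N [oN Nx Nf]] := gf (j x) eps eps0.
by apply: ltW; exact: Nf.
Qed.

Section Unitary.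
Context {R : realType} {V : completeNormedModType R[i]}.
Context (h : {dot V for @Num.conj R[i]}).
Hypothesis hV : hilbert_dot h.

Lemma unitary_norm (T : V -> V) v : unitary h T -> `|T v| = `|v|.
Proof.
move=> uT; apply/eqP; rewrite -(@eqrXn2 _ 2) //; apply/eqP.
by rewrite !hV (unitary_dot uT).
Qed.

(** Polarisation: the norm of [u + v] controls [h u v + h v u], the norm of ['i *: u + v] controls
    [h u v - h v u]. *)
Lemma isometry_dot (T : V -> V) : linear T -> (forall v, `|T v| = `|v|) ->
  forall u v, h (T u) (T v) = h u v.
Proof.
move=> linT isoT u v.
have TD x y : T (x + y) = T x + T y by have := linT 1 x y; rewrite !scale1r.
have TZ a x : T (a *: x) = a *: T x by exact: (GRing.scalable_linear linT).
have hDl x y z : h (x + y) z = h x z + h y z by exact: linearDl.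
have hDr x y z : h x (y + z) = h x y + h x z by exact: linearDr.
have hZl a x y : h (a *: x) y = a * h x y by exact: linearZl_LR.
have hZr a x y : h x (a *: y) = a^* * h x y by exact: linearZr_LR.
have norm2 x : h (T x) (T x) = h x x by rewrite -!hV isoT.
have sym x y : h (T x) (T y) + h (T y) (T x) = h x y + h y x.
  have := norm2 (x + y); rewrite TD !hDl !hDr !norm2.
  rewrite -!addrA => /addrI; rewrite addrA [RHS]addrA => /addIr.
  done.
have s1 := sym u v.
have := sym ('i%C *: u) v; rewrite TZ !hZl !hZr conjCi !mulNr.
rewrite -!mulrBr => /(mulfI (neq0Ci _)) s2.
have : h (T u) (T v) *+ 2 = h u v *+ 2.
  rewrite !mulr2n; move: s1 s2; set a := h (T u) _; set b := h (T v) _.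
  set c := h u v; set d := h v u => s1 s2.
  have -> : a + a = (a + b) + (a - b) by rewrite addrACA subrr addr0.
  by rewrite s1 s2 addrACA subrr addr0.
by move/eqP; rewrite -subr_eq0 -mulrnBl mulrn_eq0 /= subr_eq0 => /eqP.
Qed.

End Unitary.

Lemma dense_continuous_eq (K : numFieldType) (V : normedModType K)
    (X Y : topologicalType) (j : X -> Y) (f g : Y -> V) :
  dense (range j) -> continuous f -> continuous g ->
  (forall x, f (j x) = g (j x)) -> f =1 g.
Proof.
move=> dj cf cg fg y; apply/eqP; rewrite -subr_eq0 -normr_eq0; apply/eqP.
apply: le_anti; rewrite normr_ge0 andbT.
apply/ler_addgt0Pl => eps eps0; rewrite addr0.
have e2 : 0 < eps / 2 by rewrite divr_gt0.
have /cvgrPdist_lt/(_ _ e2) nf := cf y.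
have /cvgrPdist_lt/(_ _ e2) ng := cg y.
have [x [fx gx]] := dense_meet dj (filterI nf ng).
rewrite -(subrKA (f (j x))) (le_trans (ler_normD _ _)) // [leRHS]splitr.
by rewrite lerD ?ltW // fg distrC.
Qed.

Section Representation.
Context {R : realType} {V : completeNormedModType R[i]}.
Context (h : {dot V for @Num.conj R[i]}).
Hypothesis hV : hilbert_dot h.

Section Rep.
Context (G : groupType) (pi : G -> V -> V).
Hypothesis upi : unitary_rep h pi.

Lemma rep_linear g : linear (pi g).
Proof. exact: unitary_linear (unitary_rep_unitary upi g). Qed.

Lemma rep_norm g v : `|pi g v| = `|v|.
Proof. by rewrite (unitary_norm hV v (unitary_rep_unitary upi g)). Qed.

Lemma repB g u v : pi g (u - v) = pi g u - pi g v.
Proof. exact: (GRing.zmod_morphism_linear (rep_linear g)). Qed.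

Lemma rep_dist g u v : `|pi g u - pi g v| = `|u - v|.
Proof. by rewrite -repB rep_norm. Qed.

Lemma repM g k v : pi (g * k)%g v = pi g (pi k v).
Proof. by rewrite (unitary_repM upi). Qed.

Lemma rep1 v : pi 1%g v = v.
Proof. by rewrite (unitary_rep1 upi). Qed.

End Rep.

(** Strong continuity is separate continuity in the group variable; isometry makes it joint. *)
Lemma rep_cvg (G : topologicalType) (pi : G -> V -> V)
    (T : Type) (Fi : set_system T)
    {FF : Filter Fi} (a : T -> G) (b : T -> V) (g : G) (v : V) :
  (forall g u w, `|pi g u - pi g w| = `|u - w|) -> strongly_continuous pi ->
  a @ Fi --> g -> b @ Fi --> v -> pi (a t) (b t) @[t --> Fi] --> pi g v.
Proof.
move=> isom cpi ag bv; apply/cvgrPdist_lt => eps eps0.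
have e2 : 0 < eps / 2 by rewrite divr_gt0.
have c1 : pi (a t) v @[t --> Fi] --> pi g v by exact: cvg_comp ag (@cpi v g).
move/cvgrPdist_lt: c1 => /(_ _ e2) n1; move/cvgrPdist_lt: bv => /(_ _ e2) n2.
apply: filterS2 n1 n2 => t t1 t2.
rewrite -(subrKA (pi (a t) v)) (le_lt_trans (ler_normD _ _)) // [ltRHS]splitr.
by rewrite ltrD // isom.
Qed.

Lemma smooth_rep_continuous (F : tvsType R) (K : preTopologicalGroupType)
    (AK : set (chart K F)) (pi : K -> V -> V) :
  unitary_rep h pi -> smooth_rep AK pi -> strongly_continuous pi.
Proof.
move=> upi spi v g; apply/cvgrPdist_lt => eps eps0.
have e3 : 0 < eps / 3 by rewrite divr_gt0.
have nb : nbhs v (ball v (eps / 3)) by exact: nbhsx_ballx.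
have [w [vw sw]] : ball v (eps / 3) `&` smooth_vectors AK pi !=set0.
  by apply: spi; [exists v; exact: ballxx|exact: ball_open].
have cw : pi k w @[k --> g] --> pi g w by apply: sw.1; rewrite inE.
move/cvgrPdist_lt: cw => /(_ _ e3); apply: filterS => k wk.
move: vw; rewrite -ball_normE /= => vw.
have -> : eps = eps / 3 + (eps / 3 + eps / 3) by field.
rewrite -(subrKA (pi g w)) (le_lt_trans (ler_normD _ _)) // ltrD //.
  by rewrite (rep_dist upi).
rewrite -(subrKA (pi k w)) (le_lt_trans (ler_normD _ _)) // ltrD //.
by rewrite (rep_dist upi) distrC.
Qed.

Context (G K : preTopologicalGroupType) (i : K -> G).
Hypotheses (I : dense_embedding i)
  (mulG : continuous (fun p : G * G => (p.1 * p.2)%g))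
  (invG : continuous (fun x : G => (x^-1)%g)).

Lemma rep_extension_unique (pi rho : G -> V -> V) :
  strongly_continuous pi -> strongly_continuous rho ->
  (forall x, pi (i x) = rho (i x)) -> pi = rho.
Proof.
move=> cpi crho pr; apply/funext => g; apply/funext => v.
apply: (dense_continuous_eq (embedding_dense I) (cpi v) (crho v)).
by move=> x; rewrite pr.
Qed.

Lemma rep_extension (piK : K -> V -> V) :
  unitary_rep h piK -> strongly_continuous piK ->
  exists pi : G -> V -> V, [/\ unitary_rep h pi, strongly_continuous pi &
    forall x, pi (i x) = piK x].
Proof.
move=> upi cpi.
have di := embedding_dense I.
have i1 : i 1%g = 1%g by apply: (@mulgI _ (i 1%g)); rewrite -(embeddingM I) !mulg1.
have iV x : i (x^-1)%g = ((i x)^-1)%g.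
  by apply: (@mulgI _ (i x)); rewrite -(embeddingM I) !mulgV i1.
have /choice[p pP] : forall v, exists g : G -> V,
    continuous g /\ forall x, g (i x) = piK x v.
  move=> v; apply: dense_extension => // y eps eps0.
  (* By isometry, [piK x v] and [piK x' v] are as far apart as [v] and [piK (x^-1 * x') v]. It thus
     suffices that quotients of elements near [y] are near 1, which continuity in [G] provides. *)
  have := cpi v 1%g => /cvgrPdist_lt/(_ _ eps0).
  rewrite /= nbhsE => -[M [oM M1] MP].
  have [Q oQ eQ] := embedding_initial I oM.
  have Q1 : Q 1%g by move: M1; rewrite eQ /= i1.
  have cm : (fun q : G * G => (q.1^-1 * q.2)%g) @ nbhs (y, y) --> (y^-1 * y)%g.
    have c1 : (fun q : G * G => (q.1^-1, q.2)%g) @ nbhs (y, y) --> ((y^-1)%g, y).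
      have c0 : (fun q : G * G => q.1) @ nbhs (y, y) --> y by exact: cvg_fst.
      have c2 : (fun q : G * G => q.1^-1)%g @ nbhs (y, y) --> (y^-1)%g.
        exact: cvg_comp c0 (@invG y).
      have c3 : (fun q : G * G => q.2) @ nbhs (y, y) --> y by exact: cvg_snd.
      exact: (cvg_pairP c2 c3).
    exact: cvg_comp c1 (@mulG _).
  have nQ : nbhs (y^-1 * y)%g Q by apply: open_nbhs_nbhs; rewrite mulVg.
  have [[N1 N2] /= [yN1 yN2] NQ] := cm _ nQ.
  exists (N1 `&` N2); first exact: filterI.
  move=> x x' [Nx _] [_ Nx'].
  have -> : piK x' v = piK x (piK (x^-1 * x')%g v).
    by rewrite -(repM upi) mulgA mulgV mul1g.
  rewrite (rep_dist upi).
  have := MP (x^-1 * x')%g; rewrite (rep1 upi); apply.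
  by rewrite eQ /= (embeddingM I) iV; exact: (NQ (i x, i x')).
pose pi g v := p v g.
have cp v : continuous (pi^~ v) by exact: (pP v).1.
have pi_i x v : pi (i x) v = piK x v by exact: (pP v).2.
have linpi g : linear (pi g).
  move=> a u v.
  apply: (dense_continuous_eq (f := pi^~ (a *: u + v))
    (g := fun g => a *: pi g u + pi g v) di) => //.
    move=> g'; apply: cvgD; last exact: cp.
    by apply: cvgZ; [exact: cvg_cst|exact: cp].
  by move=> x; rewrite !pi_i; exact: rep_linear.
have normpi g v : `|pi g v| = `|v|.
  apply/eqP; rewrite -subr_eq0 -normr_eq0; apply/eqP.
  apply: le_anti; rewrite normr_ge0 andbT.
  apply/ler_addgt0Pl => eps eps0; rewrite addr0.
  have /cvgrPdist_lt/(_ _ eps0) nf := cp v g.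
  have [x] := dense_meet di nf.
  rewrite /= pi_i -(rep_norm upi x v) => /ltW; apply: le_trans.
  exact: ler_dist_dist.
have distpi g u v : `|pi g u - pi g v| = `|u - v|.
  by rewrite -(GRing.zmod_morphism_linear (linpi g)) normpi.
have cpig g : continuous (pi g).
  move=> v; apply/cvgrPdist_lt => eps eps0.
  have /cvgrPdist_lt/(_ _ eps0) : id @ v --> v by exact: cvg_id.
  by apply: filterS => w; rewrite distpi.
have cmul1 (g : G) : continuous (fun k : G => (g * k)%g).
  move=> k; have c1 : (fun q : G => (g, q)) @ k --> (g, k).
    by apply: cvg_pairP; [exact: cvg_cst|exact: cvg_id].
  exact: cvg_comp c1 (@mulG _).
have cmul2 (g : G) : continuous (fun k : G => (k * g)%g).
  move=> k; have c1 : (fun q : G => (q, g)) @ k --> (k, g).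
    by apply: cvg_pairP; [exact: cvg_id|exact: cvg_cst].
  exact: cvg_comp c1 (@mulG _).
(* Multiplicativity is extended one variable at a time, each time by density. *)
have mul1 x k v : pi (i x * k)%g v = pi (i x) (pi k v).
  move: k; apply: (dense_continuous_eq (f := fun k => pi (i x * k)%g v)
    (g := fun k => pi (i x) (pi k v)) di).
  - by move=> k; exact: cvg_comp (@cmul1 (i x) k) (@cp v _).
  - by move=> k; exact: cvg_comp (@cp v k) (@cpig _ _).
  - by move=> y; rewrite -(embeddingM I) !pi_i (repM upi).
have mul g k v : pi (g * k)%g v = pi g (pi k v).
  move: g; apply: (dense_continuous_eq (f := fun g => pi (g * k)%g v)
    (g := fun g => pi g (pi k v)) di).
  - by move=> g; exact: cvg_comp (@cmul2 k g) (@cp v _).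
  - exact: cp.
  - by move=> y; exact: mul1.
have pi1 v : pi 1%g v = v by rewrite -i1 pi_i (rep1 upi).
exists pi; split=> //.
- split.
  + move=> g; split.
    * exact: linpi.
    * by move=> w; exists (pi g^-1%g w); rewrite -mul mulgV pi1.
    * exact: (isometry_dot hV).
  + by apply/funext => v; rewrite pi1.
  + by move=> g k; apply/funext => v; rewrite mul.
- by move=> x; apply/funext => v; exact: pi_i.
Qed.

End Representation.

(** * Multilinear maps *)

Section Multilinear.
Context {R : realType}.

(* [pow E n] is [E ^ n] times a dummy factor [R], which provides the base case;
   [multilinear] maps ignore that factor. *)
Fixpoint pow (E : tvsType R) (n : nat) : tvsType R :=
  match n with
  | 0 => R^o
  | m.+1 => (E * pow E m)%type
  end.

Fixpoint multilinear (E W : tvsType R) (n : nat) : (pow E n -> W) -> Prop :=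
  match n return (pow E n -> W) -> Prop with
  | 0 => fun B => forall s t, B s = B t
  | m.+1 => fun B => (forall z, linear (fun y => B (y, z))) /\
      (forall y, multilinear (fun z => B (y, z)))
  end.

(* [mderiv B z] is the differential at [z] of a multilinear [B]. *)
Fixpoint mderiv (E W : tvsType R) (n : nat) :
    (pow E n -> W) -> pow E n -> pow E n -> W :=
  match n return (pow E n -> W) -> pow E n -> pow E n -> W with
  | 0 => fun _ _ _ => 0
  | m.+1 => fun B z z' =>
      B (z'.1, z.2) + mderiv (fun w => B (z.1, w)) z.2 z'.2
  end.

Fixpoint pow_map (E F : tvsType R) (phi : F -> E) (n : nat) : pow F n -> pow E n :=
  match n return pow F n -> pow E n with
  | 0 => id
  | m.+1 => fun z => (phi z.1, pow_map phi z.2)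
  end.

Fixpoint box (E : tvsType R) (S : set E) (n : nat) : set (pow E n) :=
  match n return set (pow E n) with
  | 0 => setT
  | m.+1 => S `*` @box E S m
  end.
Arguments box {E} S n _.

Lemma multilinear_comp (E W W' : tvsType R) (T : W -> W') n (B : pow E n -> W) :
  linear T -> multilinear B -> multilinear (fun z => T (B z)).
Proof.
move=> linT; elim: n B => [|n IHn] B /=; first by move=> BE s t; rewrite (BE s t).
by move=> [lB mB]; split=> [z a u v|y]; [rewrite lB linT|exact: IHn].
Qed.

Lemma multilinear_lim (E W : tvsType R) (T : Type) (Fi : set_system T)
    {FF : ProperFilter Fi} n (B : T -> pow E n -> W) (B' : pow E n -> W) :
  hausdorff_space W ->
  (\forall t \near Fi, multilinear (B t)) ->
  (forall z, B t z @[t --> Fi] --> B' z) -> multilinear B'.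
Proof.
move=> hW; elim: n B B' => [|n IHn] B B' /= mB BB'.
  move=> s t; apply: (cvg_unique hW (BB' s)).
  apply: near_cvg (BB' t); apply: filterS mB => i Bi; exact: Bi.
split=> [z a u v|y].
  have c1 : a *: B t (u, z) + B t (v, z) @[t --> Fi] --> a *: B' (u, z) + B' (v, z).
    apply: tvs_cvgD; last exact: BB'.
    by apply: tvs_cvgZ; [exact: cvg_cst|exact: BB'].
  apply: (cvg_unique hW (BB' (a *: u + v, z))).
  by apply: near_cvg c1; apply: filterS mB => t [lB _]; rewrite lB.
apply: (IHn (fun t z => B t (y, z))); last by move=> z; exact: BB'.
by apply: filterS mB => t [_ mB].
Qed.

Lemma pair_continuous (S T U : topologicalType) (f : S * T -> U) (x : S) :
  continuous f -> continuous (fun y => f (x, y)).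
Proof.
move=> cf y; have c1 : (fun z : T => (x, z)) @ y --> (x, y).
  by apply: cvg_pairP; [exact: cvg_cst|exact: cvg_id].
exact: cvg_comp c1 (@cf _).
Qed.

Lemma multilinear_derive (E W : tvsType R) n (B : pow E n -> W) (z z' : pow E n) :
  multilinear B -> continuous B -> is_dir_derive B z z' (mderiv B z z').
Proof.
elim: n B z z' => [|n IHn] B z z' /= mB cB.
  have : (fun=> 0 : W) @ (0 : R)^' --> (0 : W) by exact: cvg_cst.
  apply: near_cvg; near=> t.
  by rewrite (mB (z + t *: z') z) subrr scaler0.
case: z z' => [y w] [y' w']; case: mB => lB mB.
have c1 : B (y', w + t *: w') @[t --> (0 : R)^'] --> B (y', w).
  have c2 := @line_cvg _ _ w w'.
  exact: cvg_comp c2 (@pair_continuous _ _ _ B y' cB w).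
have c3 := IHn (fun w => B (y, w)) w w' (mB y) (@pair_continuous _ _ _ B y cB).
have : B (y', w + t *: w') + t^-1 *: (B (y, w + t *: w') - B (y, w))
    @[t --> (0 : R)^'] --> B (y', w) + mderiv (fun w => B (y, w)) w w'.
  by apply: tvs_cvgD; [exact: c1|exact: c3].
apply: near_cvg; near=> t.
have t0 : t != 0 by near: t; exact: nbhs_dnbhs_neq.
have -> : (y, w) + t *: (y', w') = (t *: y' + y, w + t *: w').
  by congr (_, _); rewrite addrC.
by rewrite lB -addrA [RHS]scalerDr scalerA mulVf // scale1r.
Unshelve. all: by end_near. Qed.

Lemma Cn_on_fst_comp n (E F1 F2 : tvsType R) (U : set E) (f : E -> F1 * F2) :
  open U -> Cn_on n U f -> Cn_on n U (fun x => (f x).1).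
Proof.
move=> oU Cf; apply: (@Cn_on_comp _ n _ _ _ U setT f fst) => //.
  exact: openT.
exact: Cn_on_fst.
Qed.

Lemma Cn_on_snd_comp n (E F1 F2 : tvsType R) (U : set E) (f : E -> F1 * F2) :
  open U -> Cn_on n U f -> Cn_on n U (fun x => (f x).2).
Proof.
move=> oU Cf; apply: (@Cn_on_comp _ n _ _ _ U setT f snd) => //.
  exact: openT.
exact: Cn_on_snd.
Qed.

(** The parameter space [X] is there for the induction: [mderiv] freezes the first factor of its
    base point, and [A'] turns that factor into a parameter. *)
Lemma Cn_on_mderiv k (X E W : tvsType R) (U : set X) n (A : X * pow E n -> W) :
  open U -> Cn_on k (U `*` setT) A ->
  Cn_on k ((U `*` setT) `*` setT)
    (fun p : (X * pow E n) * pow E n => mderiv (fun w => A (p.1.1, w)) p.1.2 p.2).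
Proof.
elim: n X U A => [|n IHn] X U A oU CA; first exact: Cn_on_cst.
have oD : open ((U `*` [set: pow E n.+1]) `*` [set: pow E n.+1]).
  by do 2![apply: open_setX; last exact: openT].
have Cid := @Cn_on_id _ k ((X * pow E n.+1) * pow E n.+1)%type
  ((U `*` [set: pow E n.+1]) `*` [set: pow E n.+1]).
have C1 := Cn_on_fst_comp oD Cid; have C2 := Cn_on_snd_comp oD Cid.
have C11 := Cn_on_fst_comp oD C1; have C12 := Cn_on_snd_comp oD C1.
have C121 := Cn_on_fst_comp oD C12; have C122 := Cn_on_snd_comp oD C12.
have C21 := Cn_on_fst_comp oD C2; have C22 := Cn_on_snd_comp oD C2.
apply: Cn_on_add => //.
  apply: (Cn_on_comp (W := U `*` [set: pow E n.+1])
    (f := fun p : (X * pow E n.+1) * pow E n.+1 => (p.1.1, (p.2.1, p.1.2.2)))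
    (g := A)) => //.
  - by apply: open_setX => //; exact: openT.
  - by move=> [[x z] z'] [[]].
  - by apply: Cn_on_pair => //; exact: Cn_on_pair.
pose A' (q : (X * E) * pow E n) := A (q.1.1, (q.1.2, q.2)).
have oU' : open (U `*` [set: E]) by apply: open_setX => //; exact: openT.
have oU'' : open ((U `*` [set: E]) `*` [set: pow E n]).
  by apply: open_setX => //; exact: openT.
have CA' : Cn_on k ((U `*` [set: E]) `*` [set: pow E n]) A'.
  have Did := @Cn_on_id _ k ((X * E) * pow E n)%type
    ((U `*` [set: E]) `*` [set: pow E n]).
  have D1 := Cn_on_fst_comp oU'' Did; have D2 := Cn_on_snd_comp oU'' Did.
  have D11 := Cn_on_fst_comp oU'' D1; have D12 := Cn_on_snd_comp oU'' D1.
  apply: (Cn_on_comp (W := U `*` [set: pow E n.+1])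
    (f := fun q : (X * E) * pow E n => (q.1.1, (q.1.2, q.2))) (g := A)) => //.
  - by apply: open_setX => //; exact: openT.
  - by move=> [[x z] z'] [[]].
  - by apply: Cn_on_pair => //; exact: Cn_on_pair.
apply: (Cn_on_comp (W := ((U `*` [set: E]) `*` [set: pow E n]) `*` [set: pow E n])
  (f := fun p : (X * pow E n.+1) * pow E n.+1 => (((p.1.1, p.1.2.1), p.1.2.2), p.2.2))
  (g := fun q : ((X * E) * pow E n) * pow E n =>
    mderiv (fun w => A' (q.1.1, w)) q.1.2 q.2)) => //.
- by apply: open_setX => //; exact: openT.
- exact: Cn_on_pair (Cn_on_pair (Cn_on_pair C11 C121) C122) C22.
- exact: IHn.
Qed.

End Multilinear.

Arguments box {R E} S n _.
Arguments pow_map {R E F} phi n _.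

Section RealNorm.
Context {R : realType} {V : completeNormedModType R[i]}.

(** Norms on [V] take values in [R[i]]; this is the same number as a real one. *)
Definition rnorm (v : realification V) : R := complex.Re (`|v : V|).

Lemma rnormE (v : V) : `|v| = (rnorm v)%:C.
Proof.
rewrite /rnorm; have := normr_ge0 v; case: `|v| => a b.
by rewrite lecE /= => /andP[/eqP -> _].
Qed.

Lemma rnormD (u v : realification V) : rnorm (u + v) <= rnorm u + rnorm v.
Proof.
by have := ler_normD (u : V) v; rewrite !rnormE -rmorphD lecR.
Qed.

Lemma rnormZ (a : R) (v : realification V) : rnorm (a *: v) = `|a| * rnorm v.
Proof.
have := normrZ a%:C (v : V); rewrite !rnormE normc_def /= expr0n addr0 sqrtr_sqr.
by rewrite -rmorphM => -[].
Qed.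

Lemma rnorm_ge0 (v : realification V) : 0 <= rnorm v.
Proof. by have := normr_ge0 (v : V); rewrite rnormE (lecR 0). Qed.

Lemma realification_hausdorff : hausdorff_space (realification V).
Proof. exact: (@norm_hausdorff _ V). Qed.

End RealNorm.

Lemma dense_range_prod (X1 X2 Y1 Y2 : topologicalType) (f : X1 -> Y1)
    (g : X2 -> Y2) :
  dense (range f) -> dense (range g) -> dense (range (fun p => (f p.1, g p.2))).
Proof.
move=> df dg D [[y1 y2] Dy] oD.
have [[A B] /= [nA nB] AB] : nbhs (y1, y2) D by exact: open_nbhs_nbhs.
have [x1 Ax] := dense_meet df nA; have [x2 Bx] := dense_meet dg nB.
by exists (f x1, g x2); split; [exact: (AB (_, _))|exists (x1, x2)].
Qed.

(** * Extension of continuous multilinear maps from a dense subspace *)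

Section MultilinearExtension.
Context {R : realType} {V : completeNormedModType R[i]} (E F : tvsType R).
Let W : tvsType R := realification V.

Definition scaled (M : R) (S : set F) : set F := [set x | S (M^-1 *: x)].

Lemma multilinear_bound (S : set F) (M c : R) n (B : pow F n -> W) :
  0 < M -> multilinear B -> (forall z, box S n z -> rnorm (B z) <= c) ->
  forall z, box (scaled M S) n z -> rnorm (B z) <= M ^+ n * c.
Proof.
move=> M0; elim: n B => [|n IHn] B /= mB Bc z.
  by move=> _; rewrite expr0 mul1r; exact: Bc.
case: mB => lB mB; case: z => [y w] [/= Sy Sw].
have -> : B (y, w) = M *: B (M^-1 *: y, w).
  have BZ a x : B (a *: x, w) = a *: B (x, w).
    exact: (GRing.scalable_linear (lB w)).
  rewrite -BZ.
  by rewrite scalerA mulfV ?scale1r // gt_eqF.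
rewrite rnormZ gtr0_norm // exprS -mulrA ler_pM2l //.
by apply: (IHn (fun w => B (_, w))) => // w' Sw'; exact: Bc.
Qed.

(** Factors are exchanged one at a time. Each of the [n] differences has one factor in the
    [d]-dilate of [S] and the others in the [M]-dilate; [1 <= M] allows the common bound
    [d * M ^+ n * c]. *)
Lemma multilinear_lipschitz (S : set F) (M d c : R) n (B : pow F n -> W) :
  1 <= M -> 0 < d -> 0 <= c -> multilinear B ->
  (forall z, box S n z -> rnorm (B z) <= c) ->
  forall z z', box (scaled M S) n z -> box (scaled M S) n z' ->
    box (scaled d S) n (z - z') ->
    rnorm (B z - B z') <= n%:R * d * M ^+ n * c.
Proof.
move=> M1 d0 c0; have M0 : 0 < M by exact: lt_le_trans M1.
elim: n B => [|n IHn] B /= mB Bc z z'.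
  move=> _ _ _; rewrite (mB z z') subrr !mul0r.
  by rewrite -(scale0r (0 : W)) rnormZ normr0 mul0r.
case: mB => lB mB; case: z z' => [y w] [y' w'] [/= Sy Sw] [/= Sy' Sw'] [/= dy dw].
have BZ a x u : B (a *: x, u) = a *: B (x, u).
  exact: (GRing.scalable_linear (lB u)).
have BB : B (y, w) - B (y', w) = B (y - y', w).
  by rewrite (GRing.zmod_morphism_linear (lB w)).
rewrite -(subrKA (B (y', w))) (le_trans (rnormD _ _)) // BB.
rewrite -natr1 !mulrDl addrC lerD //.
  have s1 : B (y', w) - B (y', w') =
      M *: (B (M^-1 *: y', w) - B (M^-1 *: y', w')).
    by rewrite scalerBr -!BZ scalerA mulfV ?scale1r // gt_eqF.
  rewrite s1 rnormZ gtr0_norm // exprS.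
  have -> : n%:R * d * (M * M ^+ n) * c = M * (n%:R * d * M ^+ n * c) by ring.
  rewrite ler_pM2l //.
  by apply: (IHn (fun w => B (_, w))) => // u Su; exact: Bc.
have -> : B (y - y', w) = d *: B (d^-1 *: (y - y'), w).
  by rewrite -BZ scalerA mulfV ?scale1r // gt_eqF.
rewrite rnormZ gtr0_norm // mul1r -mulrA ler_pM2l //.
apply: (@le_trans _ _ (M ^+ n * c)).
  by apply: (multilinear_bound (S := S) (B := fun w => B (_, w))) => // u Su; exact: Bc.
by rewrite ler_wpM2r // exprS ler_peMl // exprn_ge0 // ltW.
Qed.

Lemma box_sub (S S' : set F) n : S `<=` S' -> box S n `<=` box S' n.
Proof.
move=> SS'; elim: n => [|n IHn] //= [x w] [/= Sx Sw].
by split; [exact: SS'|exact: IHn].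
Qed.

(* [z0] is [z] with its dummy coordinate replaced by 0. *)
Lemma box_nbhs n (N : set (pow F n)) : nbhs 0 N ->
  exists2 S : set F, nbhs 0 S & forall z, box S n z ->
    exists2 z0, N z0 & forall B : pow F n -> W, multilinear B -> B z = B z0.
Proof.
elim: n N => [|n IHn] N nN.
  by exists setT => [|z _]; [exact: filterT|exists 0; [exact: nbhs_singleton|]].
have [[N1 N2] /= [n1 n2] NN] := nN.
have [S nS SN] := IHn N2 n2.
exists (N1 `&` S); first exact: filterI.
move=> [y w] [/= [N1y Sy] Sw].
have {}Sw : box S n w by apply: box_sub Sw => x [].
have [w0 N2w w0P] := SN w Sw.
by exists (y, w0); [exact: NN|move=> B [_ mB]; exact: (w0P (fun w => B (y, w)))].
Qed.

Variable phi : F -> E.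
Hypotheses (linphi : linear phi) (cphi : continuous phi) (dphi : dense (range phi))
  (embphi : forall S : set F, nbhs 0 S ->
    exists2 S' : set E, nbhs 0 S' & forall y, S' (phi y) -> S y).

Lemma pow_map_dense n : dense (range (pow_map phi n)).
Proof.
elim: n => [|n IHn] /=; last exact: dense_range_prod dphi IHn.
by move=> D [y Dy] _; exists y; split=> //; exists y.
Qed.

(** The order of choices matters: [M] depends only on [y], while [d] can still be taken as small as
    the Lipschitz bound demands. The embedding property replaces [S] by a neighbourhood in [E],
    because [y] need not come from [F]. *)
Lemma box_range (S : set F) n (y : pow E n) : nbhs 0 S ->
  exists2 M : R, 1 <= M & forall d, 0 < d -> exists2 N : set (pow E n), nbhs y N &
    forall z z' : pow F n, N (pow_map phi n z) -> N (pow_map phi n z') ->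
      [/\ box (scaled M S) n z, box (scaled M S) n z' &
          box (scaled d S) n (z - z')].
Proof.
move=> nS; have [S0 nS0 S0S] := embphi nS.
have [S' [oS' S'0 cS' S'S0]] := convex_open_nbhs nS0.
have S'S x : S' (phi x) -> S x by move=> /S'S0; exact: S0S.
have phiZ a x : phi (a *: x) = a *: phi x.
  exact: (GRing.scalable_linear linphi).
have phiB x x' : phi (x - x') = phi x - phi x'.
  exact: (GRing.zmod_morphism_linear linphi).
(* Strengthened to all [M' >= M], since the induction enlarges the constant and [scaled M S] need
   not grow with [M] when [S] is not convex. *)
suff [M M1 MP] : exists2 M : R, 1 <= M & forall d, 0 < d ->
    exists2 N : set (pow E n), nbhs y N &
    forall z z' : pow F n, N (pow_map phi n z) -> N (pow_map phi n z') ->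
      [/\ forall M', M <= M' -> box (scaled M' S) n z,
          forall M', M <= M' -> box (scaled M' S) n z' &
          box (scaled d S) n (z - z')].
  exists M => // d d0; have [N yN NP] := MP d d0.
  by exists N => // z z' Nz Nz'; have [z1 z2 zz'] := NP z z' Nz Nz'; split; auto.
elim: n y => [|n IHn] y.
  by exists 1 => // d d0; exists setT; first exact: filterT.
case: y => y w; have [M M1 MP] := IHn w.
have [t [t0 tS]] : exists t : R, 0 < t /\ S' (t *: y).
  have nS' : nbhs (0 : E) S' by exact: open_nbhs_nbhs.
  (* The punctured neighbourhood does not fix the sign of [t]; having [- y] as well permits a
     positive [t]. *)
  have : \forall t \near (0 : R)^', [/\ t != 0, S' (t *: y) & S' (t *: - y)].
    near=> t; split; near: t; [exact: nbhs_dnbhs_neq|exact: small_scale..].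
  move=> /filter_ex[t [t0 ty tNy]]; case: (ltgtP t 0) t0 => // t0 _.
    by exists (- t); rewrite oppr_gt0 t0 scaleNr -scalerN.
  by exists t.
exists (Num.max M t^-1); first by rewrite le_max M1.
move=> d d0; have [N nN NP] := MP d d0.
have ct : t *: u @[u --> y] --> t *: y.
  by apply: tvs_cvgZ; [exact: cvg_cst|exact: cvg_id].
have nt : nbhs y [set u | S' (t *: u)] by apply: ct; exact: open_nbhs_nbhs.
have cd : (fun q : E * E => d^-1 *: (q.1 - q.2)) @ nbhs (y, y) --> d^-1 *: (y - y).
  apply: tvs_cvgZ; first exact: cvg_cst.
  by apply: tvs_cvgB; [exact: cvg_fst|exact: cvg_snd].
have nd0 : nbhs (d^-1 *: (y - y)) S'.
  by rewrite subrr scaler0; exact: open_nbhs_nbhs.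
have [[N1 N2] /= [n1 n2] NN] := cd _ nd0.
exists (([set u | S' (t *: u)] `&` (N1 `&` N2)) `*` N).
  by exists ([set u | S' (t *: u)] `&` (N1 `&` N2), N) => //=; split => //;
    apply: filterI => //; exact: filterI.
move=> [x z] [x' z'] [/= [tx [N1x N2x]] Nz] [/= [tx' [N1x' N2x']] Nz'].
have [zM zM' zz'] := NP z z' Nz Nz'.
have sc u M' : S' (t *: phi u) -> t^-1 <= M' -> S (M'^-1 *: u).
  move=> tu tM'; apply: S'S; rewrite phiZ.
  have ti : 0 < t^-1 by rewrite invr_gt0.
  have M'0 : 0 < M' by exact: lt_le_trans tM'.
  have -> : M'^-1 *: phi u = (M'^-1 * t^-1) *: (t *: phi u).
    by rewrite scalerA mulfVK // gt_eqF.
  apply: convex_subset0 => //; apply/andP; split.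
    by rewrite mulr_ge0 // ?invr_ge0 ltW // invr_gt0.
  by rewrite mulrC ler_pdivrMr // mul1r.
split.
- by move=> M'; rewrite ge_max => /andP[MM' tM']; split; [exact: sc|exact: zM].
- by move=> M'; rewrite ge_max => /andP[MM' tM']; split; [exact: sc|exact: zM'].
- split => //; rewrite /scaled /=; apply: S'S; rewrite phiZ phiB.
  exact: (NN (phi x, phi x')).
Unshelve. all: by end_near. Qed.

Lemma multilinear_cauchy n (B : pow F n -> W) (y : pow E n) (eps : R) :
  multilinear B -> continuous B -> 0 < eps ->
  exists2 N : set (pow E n), nbhs y N & forall z z' : pow F n,
    N (pow_map phi n z) -> N (pow_map phi n z') -> rnorm (B z - B z') < eps.
Proof.
move=> mB cB eps0.
have [N0 nN0 N0B] : exists2 N : set (pow F n), nbhs 0 N &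
    forall z, N z -> rnorm (B z) <= rnorm (B 0) + 1.
  have nb : nbhs (B 0) (ball (B 0 : V) 1) by exact: nbhsx_ballx.
  exists (B @^-1` ball (B 0 : V) 1); first exact: cB.
  move=> z; rewrite /= -ball_normE /= distrC => dz.
  rewrite -[X in rnorm X](subrK (B 0)) addrC (le_trans (rnormD _ _)) // lerD2l.
  by move: dz; rewrite rnormE (ltcR _ 1) => /ltW.
have [S nS SP] := box_nbhs nN0.
set c := rnorm (B 0) + 1.
have c0 : 0 <= c by rewrite addr_ge0 ?rnorm_ge0.
have Sc z : box S n z -> rnorm (B z) <= c.
  by move=> /SP[z0 Nz0 /(_ B mB) ->]; exact: N0B.
have [M M1 MP] := box_range y nS.
(* The summand 1 makes [k] positive and the bound strict: with [d = eps / k] the Lipschitz estimate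
   is [(k - 1) / k * eps]. *)
pose k := n%:R * M ^+ n * c + 1.
have M0 : 0 <= M by exact: le_trans M1.
have k0 : 0 < k by rewrite ltr_wpDl // !mulr_ge0 // exprn_ge0.
have d0 : 0 < eps / k by rewrite divr_gt0.
have [N yN NP] := MP _ d0.
exists N => // z z' Nz Nz'; have [bz bz' bzz'] := NP z z' Nz Nz'.
apply: le_lt_trans (multilinear_lipschitz M1 d0 c0 mB Sc bz bz' bzz') _.
have -> : n%:R * (eps / k) * M ^+ n * c = (k - 1) / k * eps.
  by rewrite /k addrK; ring.
rewrite gtr_pMl // ltr_pdivrMr // mul1r ltrBlDr ltrDl //.
Qed.

(** Linearity in the first factor is an equation between continuous maps, valid on a dense set. For
    the other factors the induction hypothesis applies when the first one lies in [range phi]. *)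
Lemma multilinear_of_dense n (B : pow E n -> W) :
  continuous B -> multilinear (fun z => B (pow_map phi n z)) -> multilinear B.
Proof.
have linj a (u v : F) : phi (a *: u + v) = a *: phi u + phi v by exact: linphi.
elim: n B => [|n IHn] B cB /=; first by [].
move=> [lB mB].
have meq (f g : E * (E * pow E n) -> V) : continuous f -> continuous g ->
    (forall x, f (phi x.1, (phi x.2.1, pow_map phi n x.2.2)) =
               g (phi x.1, (phi x.2.1, pow_map phi n x.2.2))) -> f =1 g.
  move=> cf cg fg.
  have dr := dense_range_prod dphi (dense_range_prod dphi (@pow_map_dense n)).
  apply: (dense_continuous_eq dr cf cg) => x.
  exact: fg x.
have cproj (a : R) : continuous (fun q : E * (E * pow E n) =>
    (a *: q.1 + q.2.1, q.2.2)).
  move=> q.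
  have c22 : (fun q : E * (E * pow E n) => q.2.2) @ q --> q.2.2.
    exact: cvg_comp (@snd_continuous _ _ q) (@snd_continuous _ _ q.2).
  have c21 : (fun q : E * (E * pow E n) => q.2.1) @ q --> q.2.1.
    exact: cvg_comp (@snd_continuous _ _ q) (@fst_continuous _ _ q.2).
  apply: cvg_pairP => //; apply: tvs_cvgD => //.
  by apply: tvs_cvgZ; [exact: cvg_cst|exact: cvg_fst].
have lBE z : linear (fun y => B (y, z)).
  move=> a u v.
  apply: (meq (fun q => B (a *: q.1 + q.2.1, q.2.2))
    (fun q => (a *: (B (q.1, q.2.2) : W) + B (q.2.1, q.2.2) : W)) _ _ _ (u, (v, z))).
  - by move=> q; exact: cvg_comp (@cproj a q) (@cB _).
  - move=> q.
    have c22 : (fun q : E * (E * pow E n) => q.2.2) @ q --> q.2.2.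
      exact: cvg_comp (@snd_continuous _ _ q) (@snd_continuous _ _ q.2).
    have c12 : (fun q : E * (E * pow E n) => (q.1, q.2.2)) @ q --> (q.1, q.2.2).
      by apply: cvg_pairP => //; exact: cvg_fst.
    have c2 : (fun q : E * (E * pow E n) => (q.2.1, q.2.2)) @ q --> (q.2.1, q.2.2).
      apply: cvg_pairP => //.
      exact: cvg_comp (@snd_continuous _ _ q) (@fst_continuous _ _ q.2).
    apply: (@tvs_cvgD _ W).
      apply: (@tvs_cvgZ _ W); first exact: cvg_cst.
      exact: cvg_comp c12 (@cB _).
    exact: cvg_comp c2 (@cB _).
  - by move=> [x [x' w]] /=; rewrite -linj; exact: lB.
split=> // y.
(* An arbitrary first factor [y] is approached from within [range phi], and multilinearity in the
   others survives the limit. *)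
have wP : ProperFilter (within (range phi) (nbhs y)).
  apply: within_nbhs_proper => N nN.
  by have [x Nx] := dense_meet dphi nN; exists (phi x); split => //; exists x.
apply: (multilinear_lim (Fi := within (range phi) (nbhs y))
  (B := fun y z => B (y, z))).
- exact: realification_hausdorff.
- apply: filterS (withinT (range phi) (nbhs_filter y)) => _ [x _ <-].
  apply: IHn; last exact: mB.
  exact: pair_continuous cB.
- move=> z; have c1 : (fun y => (y, z)) @ within (range phi) (nbhs y) --> (y, z).
    apply: cvg_pairP; last exact: cvg_cst.
    by apply: cvg_within_filter; exact: cvg_id.
  exact: cvg_comp c1 (@cB _).
Qed.

Lemma multilinear_extension n (B : pow F n -> W) :
  multilinear B -> continuous B -> exists B' : pow E n -> W,
    [/\ multilinear B', continuous B' & forall z, B' (pow_map phi n z) = B z].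
Proof.
move=> mB cB.
have [B' [cB' B'B]] : exists B' : pow E n -> V, continuous B' /\
    forall z, B' (pow_map phi n z) = B z.
  apply: dense_extension; first exact: pow_map_dense.
  move=> y [e e']; rewrite ltcE /= => /andP[/eqP -> e0].
  have [N yN NP] := multilinear_cauchy y mB cB e0.
  by exists N => // z z' Nz Nz'; rewrite rnormE ltcR; exact: NP.
exists B'; split=> //; apply: multilinear_of_dense => //.
by under eq_fun do rewrite B'B.
Qed.

End MultilinearExtension.

(** * Derivatives of a smooth vector *)

Section DerivedSequence.
Context {R : realType} (F : tvsType R) (K : preTopologicalGroupType).
Context (AK : set (chart K F)) (e : F -> K) (U : set F) (l : K -> F).
Hypothesis L : log_chart AK e U l.
Context {V : completeNormedModType R[i]} (h : {dot V for @Num.conj R[i]}).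
Hypothesis hV : hilbert_dot h.
Context (pi : K -> V -> V).
Hypothesis upi : unitary_rep h pi.
Let W : tvsType R := realification V.

Let hF := lie_group_model_hausdorff (log_chart_lie L).
Let hW : hausdorff_space W := realification_hausdorff.

Lemma rep_linear_real g : linear (pi g : W -> W).
Proof. by move=> a u v; exact: (rep_linear upi g a%:C u v). Qed.

Lemma rep_continuous g : continuous (pi g : W -> W).
Proof.
move=> v; apply/(@cvgrPdist_lt _ V) => eps eps0.
have /(@cvgrPdist_lt _ V)/(_ _ eps0) : (id : V -> V) @ (v : V) --> (v : V).
  exact: cvg_id.
by apply: filterS => w; rewrite (rep_dist hV upi).
Qed.

(** Smoothness is required jointly in the logarithmic group coordinate and in the arguments of [B],
    a condition that the derived map inherits. *)
Definition derivable_family n (B : pow F n -> W) : Prop :=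
  multilinear B /\
  Cinfty_on (U `*` setT) (fun p : F * pow F n => pi (e p.1) (B p.2) : W).

Definition is_derived n (B : pow F n -> W) (B' : pow F n.+1 -> W) : Prop :=
  forall y z, t^-1 *: ((pi (e (t *: y)) (B z) : W) - B z) @[t --> (0 : R)^']
    --> B' (y, z).

Lemma derivable_family_continuous n (B : pow F n -> W) :
  derivable_family B -> continuous B.
Proof.
move=> [_ CB] z.
have D0 : ((0, z) : F * pow F n) \in U `*` setT.
  by rewrite inE; split=> //; exact: log_chart0 L.
have := Cn_on_continuous (CB 0%N) D0; rewrite /continuous_at /= => c1.
have c2 : (fun z => (0, z) : F * pow F n) @ z --> (0, z).
  by apply: cvg_pairP; [exact: cvg_cst|exact: cvg_id].
have := cvg_comp _ _ c2 c1; rewrite (exp0 L) (rep1 upi).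
apply: near_cvg; near=> w.
by rewrite /= (exp0 L) (rep1 upi).
Unshelve. all: by end_near. Qed.

Lemma derivable_family0 (v : V) : smooth_vectors AK pi v ->
  derivable_family (n := 0) (fun=> v).
Proof.
move=> sv; split=> //.
have Ce : Cinfty_on setT ((fun k => pi k v : W) \o e).
  apply: smooth_on_Cinfty.
  apply: (@smooth_on_comp _ _ _ _ _ _ _ _ AK _ _ setT) => //.
  - exact: (lie_group_atlas (log_chart_lie L)).1.
  - exact: openT.
  - exact: openT.
  - exact: log_chart_smooth L.
have oD : open (U `*` [set: pow F 0]).
  by apply: open_setX; [exact: log_chart_open L|exact: openT].
apply: (Cinfty_comp oD openT (f := fst) _ _ Ce) => // n; exact: Cn_on_fst.
Qed.

(* Since [pi (e x) (pi (e (t *: y)) (B z)) = f (log_mul (x, t *: y), z)], the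
   derivative at [t = 0] is a partial differential of [f], hence depends
   smoothly on [(x, y, z)]. *)
Lemma derivable_familyS n (B : pow F n -> W) : derivable_family B ->
  exists B' : pow F n.+1 -> W, derivable_family B' /\ is_derived B B'.
Proof.
move=> [mB CB0]; pose f (p : F * pow F n) : W := pi (e p.1) (B p.2).
have CB : Cinfty_on (U `*` setT) f := CB0.
have oU := log_chart_open L; have U0 := log_chart0 L.
have oD : open (U `*` [set: pow F n]) by apply: open_setX => //; exact: openT.
have [df [dfP Cdf]] := Cinfty_deriv hW oD CB.
have oO := open_log_mul_dom L; have Cm := log_mul_Cinfty L.
set m := log_mul e l in Cm; set Om := log_mul_dom e U in oO Cm.
have [dm [dmP Cdm]] := Cinfty_deriv hF oO Cm.
have C1f := C1_deriv_Cn dfP (Cdf 0%N); have C1m := C1_deriv_Cn dmP (Cdm 0%N).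
have Om0 x : U x -> Om (x, 0).
  by move=> Ux; rewrite /Om /log_mul_dom /= (exp0 L) mulg1; exists x.
have m0 x : U x -> m (x, 0) = x.
  by move=> Ux; rewrite /m /log_mul /= (exp0 L) mulg1 (log_chartK L).
(* The left invariant vector field of [y], evaluated at [x] in logarithmic coordinates. *)
pose lam x y := dm ((x, 0), (0, y)).
pose f' (p : F * pow F n.+1) : W := df ((p.1, p.2.2), (lam p.1 p.2.1, 0)).
pose B' (p : pow F n.+1) : W := f' (0, p).
have key x y z : U x ->
    pi (e x) (t^-1 *: ((pi (e (t *: y)) (B z) : W) - B z)) @[t --> (0 : R)^']
      --> f' (x, (y, z)).
  move=> Ux.
  have Dxz : (U `*` [set: pow F n]) (x, z) by [].
  have cm : t^-1 *: (m (x, t *: y) - x) @[t --> (0 : R)^'] --> lam x y.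
    have := dmP (x, 0) (0, y) (Om0 _ Ux); rewrite /is_dir_derive (m0 _ Ux).
    apply: near_cvg; near=> t; congr (_ *: (m _ - _)).
    by congr (_, _); rewrite /= ?scaler0 ?addr0 ?add0r.
  have cmz : (t^-1 *: (m (x, t *: y) - x), 0 : pow F n) @[t --> (0 : R)^'] -->
      (lam x y, 0 : pow F n) by apply: cvg_pairP => //; exact: cvg_cst.
  have st : t^-1 *: (f ((x, z) + t *: (t^-1 *: (m (x, t *: y) - x), 0 : pow F n))
      - f (x, z)) @[t --> (0 : R)^'] --> df ((x, z), (lam x y, 0)).
    apply: (strict_derive_comp (a := fun=> (x, z)) oD C1f Dxz _ _ cmz).
      exact: cvg_id.
    exact: cvg_cst.
  apply: near_cvg st.
  have nOm : \forall t \near (0 : R)^', Om (x, t *: y).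
    have c0 : (x, t *: y) @[t --> (0 : R)^'] --> (x, 0 : F).
      apply: cvg_pairP; first exact: cvg_cst.
      by move=> N N0; exact: (@small_scale _ _ N y N0).
    have nO : nbhs (x, 0 : F) Om by apply: open_nbhs_nbhs; split=> //; exact: Om0.
    exact: (c0 _ nO).
  near=> t.
  have t0 : t != 0 by near: t; exact: nbhs_dnbhs_neq.
  have Omt : Om (x, t *: y) by near: t; exact: nOm.
  have linx := rep_linear_real (e x).
  have -> : (x, z) + t *: (t^-1 *: (m (x, t *: y) - x), 0 : pow F n) =
      (m (x, t *: y), z).
    congr (_, _); last by rewrite /= scaler0 addr0.
    by rewrite /= scalerA divff // scale1r subrKC.
  have pZ a (u : W) : pi (e x) (a *: u) = a *: (pi (e x) u : W).
    exact: (GRing.scalable_linear linx).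
  rewrite pZ (repB upi) -(repM upi) /f /=; congr (_ *: (pi _ _ - _)).
  by rewrite /m /log_mul /= (logK L).
have dB y z : t^-1 *: ((pi (e (t *: y)) (B z) : W) - B z) @[t --> (0 : R)^']
    --> B' (y, z).
  have := key 0 y z U0; apply: near_cvg; near=> t.
  by rewrite (exp0 L) (rep1 upi).
have fB' x p : U x -> f' (x, p) = pi (e x) (B' p).
  case: p => y z Ux; apply: (cvg_unique hW (key x y z Ux)).
  exact: cvg_comp (dB y z) (@rep_continuous (e x) _).
exists B'; split=> //; split.
  split=> [z a u v|y].
    have lamL : lam 0 (a *: u + v) = a *: lam 0 u + lam 0 v.
      rewrite -(deriv_linear hF oO C1m (Om0 0 U0)) /lam; congr (dm (_, (_, _))).
      by rewrite /= scaler0 addr0.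
    rewrite /B' /f' /= lamL.
    have := deriv_linear hW oD C1f (x := (0, z)) (conj U0 Logic.I).
    move=> /(_ a (lam 0 u, 0) (lam 0 v, 0)) <-; congr (df (_, (_, _))).
    by rewrite /= scaler0 addr0.
  apply: (multilinear_lim (Fi := (0 : R)^')
    (B := fun t z => t^-1 *: ((pi (e (t *: y)) (B z) : W) - B z))) => //.
  near=> t; apply: (multilinear_comp
    (T := fun w : W => t^-1 *: ((pi (e (t *: y)) w : W) - w))) => // a u v.
  rewrite rep_linear_real opprD addrACA -scalerBr scalerDr !scalerA.
  by rewrite mulrC.
have oDS : open (U `*` [set: pow F n.+1]) by apply: open_setX => //; exact: openT.
have Cf' : Cinfty_on (U `*` [set: pow F n.+1]) f'.
  move=> k.
  have C0 := @Cn_on_id _ k (F * pow F n.+1)%type (U `*` [set: pow F n.+1]).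
  have C1 := Cn_on_fst_comp oDS C0; have C2 := Cn_on_snd_comp oDS C0.
  have C21 := Cn_on_fst_comp oDS C2; have C22 := Cn_on_snd_comp oDS C2.
  have Cc (X : tvsType R) := @Cn_on_cst _ k _ X (U `*` [set: pow F n.+1]) 0.
  have Clam : Cn_on k (U `*` [set: pow F n.+1])
      (fun p : F * pow F n.+1 => lam p.1 p.2.1).
    apply: (Cn_on_comp (W := Om `*` setT) (g := dm)
      (f := fun p : F * pow F n.+1 => ((p.1, 0), (0, p.2.1)))) => //.
    - by apply: open_setX => //; exact: openT.
    - by move=> [x p] [/= Ux _]; split=> //; exact: Om0.
    - exact: Cn_on_pair (Cn_on_pair C1 (Cc _)) (Cn_on_pair (Cc _) C21).
  apply: (Cn_on_comp (W := (U `*` [set: pow F n]) `*` setT) (g := df)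
    (f := fun p : F * pow F n.+1 => ((p.1, p.2.2), (lam p.1 p.2.1, 0)))) => //.
  - by apply: open_setX => //; exact: openT.
  - exact: Cn_on_pair (Cn_on_pair C1 C22) (Cn_on_pair Clam (Cc _)).
move=> k; apply: Cn_on_eq (Cf' k) => // -[x p] [/= Ux _]; exact: fB'.
Unshelve. all: by end_near. Qed.

Lemma derived_sequence (v : V) : smooth_vectors AK pi v ->
  exists B : forall n, pow F n -> W,
    [/\ forall n, multilinear (B n), forall n, continuous (B n),
        forall s, B 0%N s = v & forall n, is_derived (B n) (B n.+1)].
Proof.
move=> sv.
(* Each term carries its derivability, from which the next one is chosen. *)
pose fam n := {B : pow F n -> W | derivable_family B}.
have step n (b : fam n) : {b' : fam n.+1 | is_derived (sval b) (sval b')}.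
  apply: cid; have [B' [dB' BB']] := derivable_familyS (svalP b).
  by exists (exist _ B' dB').
pose b := fix b n : fam n := match n return fam n with
  | 0 => exist _ (fun=> v) (derivable_family0 sv)
  | m.+1 => sval (step m (b m)) end.
exists (fun n => sval (b n)); split=> [n|n|//|n].
- exact: (svalP (b n)).1.
- exact: derivable_family_continuous (svalP (b n)).
- exact: svalP (step n (b n)).
Qed.

End DerivedSequence.

(** * Smoothness of the extended orbit maps *)

Section ExtendedDerivatives.
Context {R : realType} (E F : tvsType R) (G K : preTopologicalGroupType).
Context (AG : set (chart G E)) (e : E -> G) (U : set E) (l : G -> E).
Context (AK : set (chart K F)) (eK : F -> K) (UK : set F) (lK : K -> F).
Hypotheses (L : log_chart AG e U l) (LK : log_chart AK eK UK lK).
Context (i : K -> G).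
Hypothesis I : dense_embedding i.
Variable phi : F -> E.
Hypothesis phiP : forall y (t : R), i (eK (t *: y)) = e (t *: phi y).
Context {V : completeNormedModType R[i]} (h : {dot V for @Num.conj R[i]}).
Hypothesis hV : hilbert_dot h.
Context (pi : G -> V -> V) (piK : K -> V -> V).
Hypotheses (upi : unitary_rep h pi) (cpi : strongly_continuous pi).
Hypotheses (upiK : unitary_rep h piK) (pi_i : forall x, pi (i x) = piK x).
Let W : tvsType R := realification V.

Let hE := lie_group_model_hausdorff (log_chart_lie L).
Let hW : hausdorff_space W := realification_hausdorff.

Variables (B : forall n, pow F n -> W) (C : forall n, pow E n -> W).
Arguments B : clear implicits.
Arguments C : clear implicits.
Hypotheses (mB : forall n, multilinear (B n))
  (dB : forall n, is_derived eK piK (B n) (B n.+1)).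
Hypotheses (mC : forall n, multilinear (C n)) (cC : forall n, continuous (C n))
  (CB : forall n z, C n (pow_map phi n z) = B n z).

Let linphi := lie_morphism_linear L LK I phiP.
Let dphi := lie_morphism_dense L LK I phiP.

Lemma rnorm_nbhs (c : W) (S : set W) : nbhs c S ->
  exists2 eps : R, 0 < eps & forall w, rnorm (w - c) < eps -> S w.
Proof.
move=> /(@nbhs_ballP _ V)[[r r'] /=].
rewrite ltcE /= => /andP[/eqP -> r0] rS; exists r => // w wr; apply: rS.
by rewrite -ball_normE /= distrC rnormE ltcR.
Qed.

Lemma nbhs_rnorm (c : W) (eps : R) : 0 < eps ->
  nbhs c [set w | rnorm (w - c) < eps].
Proof.
move=> eps0; have e0 : 0 < eps%:C by rewrite (ltcR 0).
apply: filterS (@nbhsx_ballx _ V (c : V) _ e0) => w.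
by rewrite -ball_normE /= distrC rnormE ltcR.
Qed.

Lemma rnorm_ball_nbhs (c w : W) (eps : R) : rnorm (w - c) < eps ->
  nbhs w [set w | rnorm (w - c) < eps].
Proof.
move=> wc; have d0 : 0 < eps - rnorm (w - c) by rewrite subr_gt0.
apply: filterS (nbhs_rnorm w d0) => w' /= w'w.
by rewrite -(subrKA w) (le_lt_trans (rnormD _ _)) // -ltrBrDr.
Qed.

Lemma convex_rnorm_ball (c : W) (eps : R) :
  convex_subset [set w : W | rnorm (w - c) < eps].
Proof.
move=> x y s /andP[s0 s1] /= xc yc.
have -> : s *: x + (1 - s) *: y - c = s *: (x - c) + (1 - s) *: (y - c).
  rewrite !scalerBr addrACA -opprD -scalerDl.
  by rewrite [s + _]addrC subrK scale1r.
rewrite (le_lt_trans (rnormD _ _)) // !rnormZ !ger0_norm ?subr_ge0 //.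
have -> : eps = s * eps + (1 - s) * eps by ring.
(* For [s = 0] the strict inequality comes from [y], otherwise from [x]. *)
have [->|sN0] := eqVneq s 0; first by rewrite !mul0r !add0r subr0 !mul1r.
by rewrite ltr_leD // ?ltr_pM2l ?lt0r ?sN0 // ler_wpM2l ?subr_ge0 // ltW.
Qed.

Let pi_cvg (T : Type) (Fi : set_system T) (FF : Filter Fi) (a : T -> G)
    (b : T -> W) g (v : W) :
  a @ Fi --> g -> b @ Fi --> v -> (pi (a t) (b t) : W) @[t --> Fi] --> (pi g v : W).
Proof. by apply: rep_cvg => // k u w; exact: (rep_dist hV upi). Qed.

Let e_cvg (T : Type) (Fi : set_system T) (FF : Filter Fi) (a : T -> E) x :
  a @ Fi --> x -> e (a t) @[t --> Fi] --> e x.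
Proof. by move=> ax; exact: cvg_comp ax (@exp_continuous _ _ _ _ _ _ _ L x). Qed.

Let quot n (t : R) (p : E * pow E n) : W :=
  t^-1 *: ((pi (e (t *: p.1)) (C n p.2) : W) - C n p.2).

(** For fixed [t], this lets values at arbitrary points be approximated by values on the dense
    subspace. *)
Lemma quot_continuous n t : continuous (@quot n t).
Proof.
move=> p; apply: tvs_cvgZ; first exact: cvg_cst.
have c2 : C n q.2 @[q --> p] --> C n p.2.
  exact: cvg_comp (@snd_continuous _ _ p) (@cC n p.2).
apply: tvs_cvgB => //; apply: pi_cvg => //; apply: e_cvg.
by apply: tvs_cvgZ; [exact: cvg_cst|exact: cvg_fst].
Qed.

(* On the dense subgroup [i K] the mean value theorem applies along
   [s |-> e (s *: t *: phi a)], where the derivative of the orbit is known. *)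
Lemma quot_mean_value n (S : set W) (t : R) (a : F) (b : pow F n) : t != 0 ->
  convex_subset S ->
  (forall s, 0 <= s <= 1 ->
     nbhs (pi (e ((s * t) *: phi a)) (C n.+1 (phi a, pow_map phi n b)) : W) S) ->
  S (quot t (phi a, pow_map phi n b)).
Proof.
move=> t0 cS SP.
have lin g : linear (piK g : W -> W) by exact: (rep_linear_real upiK).
have cpiK g : continuous (piK g : W -> W) by exact: (rep_continuous hV upiK).
have := @convex_mean_value _ W S
  (fun s => t^-1 *: (piK (eK ((s * t) *: a)) (B n b) : W))
  (fun s => (pi (e ((s * t) *: phi a)) (C n.+1 (phi a, pow_map phi n b)) : W)) cS SP.
rewrite mul1r mul0r scale0r (exp0 LK) (rep1 upiK) -scalerBr /quot /= CB.
rewrite -phiP pi_i; apply.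
move=> s _.
rewrite -phiP pi_i (CB (n := n.+1) (a, b)).
have BZ : B n.+1 (t *: a, b) = t *: B n.+1 (a, b).
  have [lB _] := mB n.+1.
  exact: (GRing.scalable_linear (lB b)).
have pZ g r (u : W) : piK g (r *: u) = r *: (piK g u : W).
  exact: (GRing.scalable_linear (lin g)).
have d1 := @dB n (t *: a) b.
have d2 := cvg_comp _ _ d1 (@cpiK (eK ((s * t) *: a)) _).
have : t^-1 *: (piK (eK ((s * t) *: a))
      (r^-1 *: ((piK (eK (r *: (t *: a))) (B n b) : W) - B n b)) : W)
    @[r --> (0 : R)^'] -->
    t^-1 *: (piK (eK ((s * t) *: a)) (B n.+1 (t *: a, b)) : W).
  by apply: tvs_cvgZ; [exact: cvg_cst|exact: d2].
rewrite BZ pZ scalerA mulVf // scale1r; apply: near_cvg; near=> r.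
have er : eK (((s + r) * t) *: a) = (eK ((s * t) *: a) * eK (r *: (t *: a)))%g.
  by rewrite mulrDl (log_chart_expD LK) scalerA.
by rewrite pZ (repB upiK) er (repM upiK) -scalerBr !scalerA mulrC.
Unshelve. all: by end_near. Qed.

(* The mean value estimate involves [C] only, so it passes from the dense
   subspace [range phi] to [E]; this is where differentiability along [E] comes
   from. *)
Lemma quot_cvg n (y : E) (z : pow E n) :
  quot p.1 p.2 @[p --> filter_prod ((0 : R)^') (nbhs (y, z))] --> C n.+1 (y, z).
Proof.
set c := C n.+1 (y, z); move=> S /rnorm_nbhs[eps eps0 epsS].
(* One half is for the mean value estimate on the dense subspace, the other for the passage from
   there to an arbitrary point. *)
have e2 : 0 < eps / 2 by rewrite divr_gt0.
have cyz : (pi (e q.1) (C n.+1 q.2) : W) @[q --> nbhs ((0 : E), (y, z))] --> c.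
  have -> : c = pi (e 0) c by rewrite (exp0 L) (rep1 upi).
  apply: pi_cvg; first by apply: e_cvg; exact: cvg_fst.
  have s2 : (fun q : E * (E * pow E n) => q.2) @ nbhs ((0 : E), (y, z)) --> (y, z).
    exact: cvg_snd.
  exact: cvg_comp s2 (@cC n.+1 (y, z)).
have [[N0 N1] /= [nN0 nN1] N01] := cyz _ (nbhs_rnorm c e2).
have [N [oN N00 cN NN0]] := convex_open_nbhs nN0.
have sc : (fun q : R * (E * pow E n) => q.1 *: q.2.1)
    @ filter_prod (nbhs (0 : R)) (nbhs (y, z)) --> (0 : E).
  have c1 : (fun q : R * (E * pow E n) => q.2.1)
      @ filter_prod (nbhs (0 : R)) (nbhs (y, z)) --> y.
    have s2 : (fun q : R * (E * pow E n) => q.2)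
        @ filter_prod (nbhs (0 : R)) (nbhs (y, z)) --> (y, z) by exact: cvg_snd.
    exact: cvg_comp s2 (@fst_continuous _ _ (y, z)).
  have c0 : (fun q : R * (E * pow E n) => q.1)
      @ filter_prod (nbhs (0 : R)) (nbhs (y, z)) --> (0 : R) by exact: cvg_fst.
  have c2 := tvs_cvgZ c0 c1; rewrite scale0r in c2; exact: c2.
have [[A P] /= [[d /= d0 dA] nP] AP] := sc _ (open_nbhs_nbhs (conj oN N00)).
have : nbhs (y, z) (P `&` N1) by exact: filterI.
rewrite nbhsE => -[Q [oQ Qyz] QP].
exists ([set t | `|t| < d /\ t != 0], Q) => /=.
  split; last by exists Q.
  exists d => //= t /= td t0; split => //.
  by move: td; rewrite sub0r normrN.
move=> [t p] /= [[td t0] Qp]; apply: epsS.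
(* The approximating pair may depend on [t] and [p], because the mean value estimate holds
   throughout neighbourhoods fixed beforehand. *)
have nq := @quot_continuous n t p _ (nbhs_rnorm _ e2).
have dr : dense (range (pow_map phi n.+1)) by exact: pow_map_dense.
have [[a b] [Qab qab]] := dense_meet dr (filterI (open_nbhs_nbhs (conj oQ Qp)) nq).
have [Pab N1ab] := QP _ Qab.
have qS : rnorm (quot t (phi a, pow_map phi n b) - c) < eps / 2.
  apply: (quot_mean_value (S := [set w | rnorm (w - c) < eps / 2])) => //.
    exact: convex_rnorm_ball.
  move=> s /andP[s0 s1].
  have NS : N ((s * t) *: phi a).
    have tN : N (t *: phi a).
      apply: (AP (t, (phi a, pow_map phi n b))); split => //; apply: dA.
      by rewrite /= sub0r normrN.
    by rewrite -scalerA; apply: convex_subset0; rewrite ?s0.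
  have w0 := N01 (_, _) (conj (NN0 _ NS) N1ab).
  exact: rnorm_ball_nbhs.
move: qab => /= qab.
rewrite -(subrKA (quot t (phi a, pow_map phi n b))) (le_lt_trans (rnormD _ _)) //.
rewrite [ltRHS]splitr ltrD //.
rewrite -(opprB (quot _ _)) -scaleN1r rnormZ normrN1 mul1r.
exact: qab.
Qed.

Let Psi n (p : E * pow E n) : W := pi (e p.1) (C n p.2).

Let Psi_continuous n : continuous (@Psi n).
Proof.
move=> p; apply: pi_cvg; first by apply: e_cvg; exact: cvg_fst.
exact: cvg_comp (@snd_continuous _ _ p) (@cC n p.2).
Qed.

Let rep_linear_G g : linear (pi g : W -> W).
Proof. by move=> a u v; exact: (rep_linear upi g a%:C u v). Qed.

Let pi_continuous g : continuous (pi g : W -> W).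
Proof. by move=> v; apply: pi_cvg; [exact: cvg_cst|exact: cvg_id]. Qed.

Let piZ g r (u : W) : pi g (r *: u) = r *: (pi g u : W).
Proof. exact: (GRing.scalable_linear (rep_linear_G g)). Qed.

(* The derivative of [Psi n] is built from [Psi n.+1], [Psi n] and smooth maps,
   so the induction on [k] has to treat all [n] simultaneously. *)
Lemma orbit_family_Cn k n : Cn_on k ([set: E] `*` [set: pow E n]) (@Psi n).
Proof.
have oO := open_log_mul_dom L; have Cm := log_mul_Cinfty L.
set m := log_mul e l in Cm; set Om := log_mul_dom e U in oO Cm.
have [dm [dmP Cdm]] := Cinfty_deriv hE oO Cm.
have OmN x : Om (- x, x).
  by rewrite /Om /log_mul_dom /= (expN L) mulVg; exact: im_log_chart1 L.
have mN x : m (- x, x) = 0 by rewrite /m /log_mul /= (expN L) mulVg (log1 L).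
(* The left logarithmic derivative of [e] at [x] in direction [x']. *)
pose kap x x' := dm ((- x, x), (0, x')).
have oEn j : open ([set: E] `*` [set: pow E j]) by apply: open_setX; exact: openT.
elim: k n => [|k IHk] n; first by split=> // p _; exact: Psi_continuous.
split; first by move=> p _; exact: Psi_continuous.
exists (fun q : (E * pow E n) * (E * pow E n) =>
  Psi (n := n.+1) (q.1.1, (kap q.1.1 q.2.1, q.1.2)) +
  mderiv (fun w => Psi (q.1.1, w)) q.1.2 q.2.2); split.
- move=> [x z] [x' z'] _ /=.
  have ckap : t^-1 *: m (- x, x + t *: x') @[t --> (0 : R)^'] --> kap x x'.
    have := dmP (- x, x) (0, x') (OmN x); rewrite /is_dir_derive mN.
    apply: near_cvg; near=> t; rewrite subr0; congr (_ *: m _).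
    by congr (_, _); rewrite /= scaler0 addr0.
  (* Both the direction and the multilinear argument move with [t], which is why [quot_cvg] is a
     joint limit. *)
  have c1 : (t, (t^-1 *: m (- x, x + t *: x'), z + t *: z')) @[t --> (0 : R)^'] -->
      filter_prod ((0 : R)^') (nbhs (kap x x', z)).
    apply: cvg_filter_prod; first exact: cvg_id.
    by apply: cvg_pairP => //; exact: line_cvg.
  have c2 := cvg_comp _ _ c1 (@quot_cvg n (kap x x') z).
  have c3 := cvg_comp _ _ c2 (@pi_continuous (e x) _).
  have mPsi : multilinear (fun w => Psi (n := n) (x, w)).
    by apply: (multilinear_comp (T := pi (e x) : W -> W)); [exact: rep_linear_G|].
  have c4 := @multilinear_derive _ _ _ _ _ z z' mPsi
    (@pair_continuous _ _ _ (@Psi n) x (@Psi_continuous n)).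
  (* The increment is split at [pi (e x) (C n (z + t *: z'))]: first the group element changes, then
     the multilinear argument. *)
  refine (near_cvg _ (tvs_cvgD c3 c4)).
  have nOm : \forall t \near (0 : R)^', Om (- x, x + t *: x').
    have c0 : (- x, x + t *: x') @[t --> (0 : R)^'] --> (- x, x).
      by apply: cvg_pairP; [exact: cvg_cst|exact: line_cvg].
    have nO : nbhs (- x, x) Om by apply: open_nbhs_nbhs; split.
    exact: (c0 _ nO).
  near=> t.
  have t0 : t != 0 by near: t; exact: nbhs_dnbhs_neq.
  have Omt : Om (- x, x + t *: x') by near: t; exact: nOm.
  rewrite /quot /Psi /= scalerA divff // scale1r piZ -[LHS]scalerDr (repB upi).
  rewrite -(repM upi) /m /log_mul /= (logK L) // (expN L) mulgA mulgV mul1g.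
  by rewrite subrKA.
- have oD : open (([set: E] `*` [set: pow E n]) `*` [set: E * pow E n]).
    by apply: open_setX => //; exact: openT.
  have C0 := @Cn_on_id _ k ((E * pow E n) * (E * pow E n))%type
    (([set: E] `*` [set: pow E n]) `*` [set: E * pow E n]).
  have C1 := Cn_on_fst_comp oD C0; have C2 := Cn_on_snd_comp oD C0.
  have C11 := Cn_on_fst_comp oD C1; have C12 := Cn_on_snd_comp oD C1.
  have C21 := Cn_on_fst_comp oD C2; have C22 := Cn_on_snd_comp oD C2.
  have Cz := @Cn_on_cst _ k _ E
    (([set: E] `*` [set: pow E n]) `*` [set: E * pow E n]) 0.
  have CN : Cn_on k (([set: E] `*` [set: pow E n]) `*` [set: E * pow E n])
      (fun q : (E * pow E n) * (E * pow E n) => - q.1.1).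
    apply: (Cn_on_comp (W := setT) (g := fun x : E => - x)) oD openT _ C11 _ => //.
    apply: Cn_on_linear; last exact: opp_continuous.
    by move=> a u v; rewrite opprD scalerN.
  have Ckap : Cn_on k (([set: E] `*` [set: pow E n]) `*` [set: E * pow E n])
      (fun q : (E * pow E n) * (E * pow E n) => kap q.1.1 q.2.1).
    apply: (Cn_on_comp (W := Om `*` setT) (g := dm)
      (f := fun q : (E * pow E n) * (E * pow E n) =>
        ((- q.1.1, q.1.1), (0, q.2.1)))) => //.
    + by apply: open_setX => //; exact: openT.
    + by move=> [[x z] p] _; split=> //; exact: OmN.
    + exact: Cn_on_pair (Cn_on_pair CN C11) (Cn_on_pair Cz C21).
  apply: Cn_on_add => //.
    apply: (Cn_on_comp (g := @Psi n.+1) (W := [set: E] `*` [set: pow E n.+1])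
      (f := fun q : (E * pow E n) * (E * pow E n) =>
        (q.1.1, (kap q.1.1 q.2.1, q.1.2)))) => //.
      by apply: open_setX; exact: openT.
    exact: Cn_on_pair C11 (Cn_on_pair Ckap C12).
  apply: (Cn_on_comp (W := ([set: E] `*` [set: pow E n]) `*` [set: pow E n])
    (g := fun p : (E * pow E n) * pow E n => mderiv (fun w => Psi (p.1.1, w)) p.1.2 p.2)
    (f := fun q : (E * pow E n) * (E * pow E n) => (q.1, q.2.2))) => //.
  + by apply: open_setX; [exact: oEn|exact: openT].
  + exact: Cn_on_pair C1 C22.
  + by apply: Cn_on_mderiv; [exact: openT|exact: IHk].
Unshelve. all: by end_near. Qed.

(** Smoothness of [x |-> pi (e x) v] spreads over [G] by translation: near [g] the orbit map is the
    continuous linear [pi g] after this map after the logarithm of [g^-1 * x]. *)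
Lemma orbit_smooth (v : V) : (forall s, C 0 s = v) -> smooth_vectors AG pi v.
Proof.
move=> C0v.
have CE : Cinfty_on [set: E] (fun x => pi (e x) v : W).
  move=> k; apply: (@Cn_on_eq _ k _ _ _ (fun x => Psi (n := 0) (x, 0))).
  - exact: openT.
  - by move=> x _; rewrite /Psi /= C0v.
  - apply: (Cn_on_comp (W := [set: E] `*` [set: pow E 0]) (g := @Psi 0)
      (f := fun x : E => (x, 0 : pow E 0))) => //.
    + exact: openT.
    + by apply: open_setX; exact: openT.
    + by apply: Cn_on_pair; [exact: Cn_on_id|exact: Cn_on_cst].
    + exact: orbit_family_Cn.
have oeU := log_chart_im L.
apply: smooth_on_local => [||g _]; [exact: hW|exact: openT|].
exists [set x | (e @` U) (g^-1 * x)%g]; split.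
- exact: (lmul_preimage_open L).
- by rewrite /= mulVg; exact: im_log_chart1 L.
have Cg : Cinfty_on [set: E] ((pi g : W -> W) \o (fun x => pi (e x) v : W)).
  apply: (Cinfty_comp openT openT _ CE) => // k.
  by apply: Cn_on_linear; [exact: rep_linear_G|exact: pi_continuous].
apply: (smooth_on_eq (f := ((pi g : W -> W) \o (fun x => pi (e x) v : W)) \o
  (fun x => l (g^-1 * x)%g))).
- exact: (lmul_preimage_open L).
- move=> x gx /=; rewrite (logK L) // -(repM upi).
  by rewrite mulgA mulgV mul1g.
apply: (@smooth_on_comp _ _ _ _ _ _ _ _ (model_atlas E) _ _ setT).
- exact: model_atlas_cover.
- exact: hW.
- exact: (lmul_preimage_open L).
- exact: openT.
- by [].
- exact: log_lmul_smooth L _.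
- exact: Cinfty_smooth_on.
Qed.

End ExtendedDerivatives.

(** * Application to the inclusion of a dense subgroup *)

Lemma subgroup_dense_embedding (G : preTopologicalGroupType) (H : subgroup G) :
  dense (H : set G) -> dense_embedding (val : subgroup_type H -> G).
Proof.
move=> dH; split.
- exact: valM.
- exact: val_inj.
- exact: initial_continuous.
- by move=> O [A oA <-]; exists A.
- move=> D D0 oD; have [x [Dx Hx]] := dH D D0 oD.
  exists x; split => //.
  by exists (exist _ x (mem_set Hx)).
Qed.

Theorem corollary4p14 (R : realType)
  (E : tvsType R) (G : preTopologicalGroupType) (AG : set (chart G E))
  (hG : locally_exponential AG)
  (F : tvsType R) (H : subgroup G) (AH : set (chart (subgroup_type H) F))
  (hH : locally_exponential AH) (denseH : dense (H : set G))
  (V : completeNormedModType R[i]) (h : {dot V for @Num.conj R[i]})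
  (hV : hilbert_dot h)
  (piH : subgroup_type H -> V -> V)
  (unitH : unitary_rep h piH) (smoothH : smooth_rep AH piH) :
  exists pi : G -> V -> V,
    [/\ unique (fun rho : G -> V -> V =>
          [/\ unitary_rep h rho, strongly_continuous rho &
              forall x : subgroup_type H, rho (val x) = piH x]) pi,
        smooth_rep AG pi &
        smooth_vectors AG pi = smooth_vectors AH piH].
Proof.
have I := subgroup_dense_embedding denseH.
have [e [U [l L]]] := locally_exponential_log_chart hG.
have [eH [UH [lH LH]]] := locally_exponential_log_chart hH.
have cH := smooth_rep_continuous hV unitH smoothH.
have [pi [upi cpi piE]] := rep_extension hV I (mulg_continuous L)
  (invg_continuous L) unitH cH.
have [phi phiP] := exists_lie_morphism L LH I.
have svE : smooth_vectors AG pi = smooth_vectors AH piH.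
  apply/seteqP; split=> v.
    move=> sv; rewrite /smooth_vectors /= /smooth.
    suff svH : smooth_on AH (model_atlas (realification V)) setT
        ((fun g => pi g v : realification V) \o (val : subgroup_type H -> G)).
      by apply: smooth_on_eq svH => [|x _]; [exact: openT|rewrite /= piE].
    apply: (@smooth_on_comp _ _ _ _ _ _ _ _ AG _ _ setT).
    - exact: (lie_group_atlas (log_chart_lie L)).1.
    - exact: realification_hausdorff.
    - exact: openT.
    - exact: openT.
    - by [].
    - have es := embedding_smooth L LH I phiP.
      exact es.
    - exact: sv.
  move=> sv.
  have [B [mB cB B0 dB]] := derived_sequence LH hV unitH sv.
  have ext n := multilinear_extension (lie_morphism_linear L LH I phiP)
    (lie_morphism_dense L LH I phiP)
    (lie_morphism_embedding L LH I phiP) (mB n) (cB n).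
  pose C n := sval (cid (ext n)).
  have CP n : [/\ multilinear (C n), continuous (C n) &
      forall z, C n (pow_map phi n z) = B n z] by exact: svalP (cid (ext n)).
  apply: (orbit_smooth L LH I phiP hV upi cpi unitH piE mB dB (C := C)).
  - by move=> n; have [] := CP n.
  - by move=> n; have [] := CP n.
  - by move=> n; have [] := CP n.
  - by move=> s; have [_ _ /(_ s)] := CP 0%N; rewrite B0.
exists pi; split=> //; last by rewrite /smooth_rep svE.
split=> // rho [_ crho rhoE].
by apply: (rep_extension_unique I cpi crho) => x; rewrite piE rhoE.
Qed.
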